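(* Let $n\ge 1$ be a fixed integer and let $\mathcal X,\mathcal Y$ be fixed finite alphabets. Then the set $$S^{FB}_{SE}(\text{unsolvable})=\{(A,W)\in \mathcal M_c^{n\times n}\times \mathcal{CH}_c(\mathcal X,\mathcal Y): C_0^{FB}(W)<\eta(A)\}$$ is semi-decidable (as a subset of $\mathcal M_c^{n\times n}\times \mathcal{CH}_c(\mathcal X,\mathcal Y)$).
   Context: Computability. A sequence of rationals $(r_k)_{k\in\mathbb N}$ is computable if $r_k=(-1)^{s(k)}a(k)/b(k)$ for recursive functions $a,b,s:\mathbb N\to\mathbb N$ with $b(k)\neq 0$ for all $k$. A real $x$ is computable if there is a computable sequence of rationals $(r_k)$ with $|x-r_k|<2^{-k}$ for all $k$; $\mathbb R_c$ is the set of computable reals. A computable real is given as input to a Turing machine by a description (a program) of such a sequence; computable matrices and computable channels are given by descriptions of all their entries. A subset $M$ of a set $D$ of such objects is semi-decidable if there is a Turing machine (with the single output state ''stop'') that, for every input in $D$, halts if the input lies in $M$ and computes forever if it does not. Plants. $\mathcal M_c^{n\times n}$ is the set of $n\times n$ matrices $A$ with entries in $\mathbb R_c$ that are unstable, i.e. have at least one eigenvalue $\lambda$ with $|\lambda|\ge 1$. With $\lambda_1(A),\dots,\lambda_n(A)$ the (complex) eigenvalues of $A$ repeated according to algebraic multiplicity, $\eta(A)=\sum_{j:|\lambda_j(A)|\ge 1}\log_2|\lambda_j(A)|$. Channels. $\mathcal{CH}_c(\mathcal X,\mathcal Y)$ is the set of computable channels, i.e. families $W=(W(y|x))_{x\in\mathcal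 X,y\in\mathcal Y}$ such that for each $x$, $W(\cdot|x)$ is a probability distribution on $\mathcal Y$ with all values in $\mathbb R_c$. For $x^m\in\mathcal X^m$, $y^m\in\mathcal Y^m$ let $W^m(y^m|x^m)=\prod_{j=1}^m W(y_j|x_j)$. Let $M(W,m)$ be the maximum cardinality of a set of words $x^m\in\mathcal X^m$ whose vectors $W^m(\cdot|x^m)$ are pairwise orthogonal (have pairwise disjoint supports). The zero-error capacity is $C_0(W)=\liminf_{m\to\infty}\frac1m\log_2 M(W,m)$. The zero-error capacity with feedback is given by (Shannon) $C_0^{FB}(W)=0$ if $C_0(W)=0$, and otherwise $$C_0^{FB}(W)=\max_{P}\min_{y\in\mathcal Y}\log_2\frac{1}{\sum_{x:W(y|x)>0}P(x)},$$ where $P$ ranges over all probability distributions on $\mathcal X$ (with $\log_2(1/0)=+\infty$). *)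

(* Defs.v *)
From HB Require Import structures.
From mathcomp Require Import all_boot all_order all_algebra.
From mathcomp Require Import complex.
From mathcomp Require Import all_classical all_reals all_analysis.

Set Implicit Arguments.
Unset Strict Implicit.
Unset Printing Implicit Defensive.

Import Order.TTheory GRing.Theory Num.Theory.
Local Open Scope ring_scope.

(** Programs carry no arity: they are run on a list of arguments, and missing
    arguments count as 0. *)
Inductive prog : Type :=
| Zero
| Succ
| Proj of nat
| Comp of prog & seq prog
| Rec of prog & prog
| Mu of prog.

(** [eval f v y]: the program [f] terminates on [v] with value [y]. *)
Inductive eval : prog -> seq nat -> nat -> Prop :=
| eval_Zero v : eval Zero v 0%N
| eval_Succ v : eval Succ v (head 0%N v).+1
| eval_Proj i v : eval (Proj i) v (nth 0%N v i)
| eval_Comp f gs v ws y :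
    evals gs v ws -> eval f ws y -> eval (Comp f gs) v y
| eval_Rec0 f g v y : eval f v y -> eval (Rec f g) (0%N :: v) y
| eval_RecS f g k v y z :
    eval (Rec f g) (k :: v) y -> eval g (k :: y :: v) z ->
    eval (Rec f g) (k.+1 :: v) z
| eval_Mu f v k (w : nat -> nat) :
    (forall i, (i < k)%N -> eval f (i :: v) (w i).+1) ->
    eval f (k :: v) 0%N ->
    eval (Mu f) v k
with evals : seq prog -> seq nat -> seq nat -> Prop :=
| evals_nil v : evals [::] v [::]
| evals_cons g gs v y ys :
    eval g v y -> evals gs v ys -> evals (g :: gs) v (y :: ys).

Definition computes (f : prog) (a : nat -> nat) : Prop :=
  forall k, eval f [:: k] (a k).

(** [npair] is injective but not surjective: since [x <= x + y], the integer
    square root of [npair x y] is [x + y]. *)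
Definition npair (x y : nat) : nat := ((x + y) ^ 2 + x)%N.

Fixpoint gnum (f : prog) : nat :=
  match f with
  | Zero => npair 0 0
  | Succ => npair 1 0
  | Proj i => npair 2 i
  | Comp f gs =>
      npair 3 (npair (gnum f) (foldr (fun g c => (npair (gnum g) c).+1) 0%N gs))
  | Rec f g => npair 4 (npair (gnum f) (gnum g))
  | Mu f => npair 5 (gnum f)
  end.

Inductive move := MoveLeft | Stay | MoveRight.

(** The tape alphabet consists of the blank [None], the two input letters
    [Some (inl b)], and finitely many auxiliary letters [Some (inr c)]. *)
Definition symbol (W : finType) : Type := option (bool + W).

Record turing_machine := TuringMachine {
  tm_state : finType;
  tm_work : finType;
  tm_start : tm_state;
  tm_stop : tm_state;
  tm_trans : tm_state -> symbol tm_work -> tm_state * symbol tm_work * move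
}.

(** A two-way infinite tape: the cells to the left of the head (nearest first),
    the scanned cell, and the cells to its right; every cell beyond the two
    lists is blank. *)
Definition tape (W : finType) : Type :=
  (seq (symbol W) * symbol W * seq (symbol W))%type.

Definition move_head (W : finType) (m : move) (t : tape W) : tape W :=
  let: (l, c, r) := t in
  match m with
  | MoveLeft => (behead l, head None l, c :: r)
  | Stay => t
  | MoveRight => (c :: l, head None r, behead r)
  end.

Definition tm_step (T : turing_machine) (c : tm_state T * tape (tm_work T)) :
    tm_state T * tape (tm_work T) :=
  let: (q, (l, s, r)) := c in
  let: (q', s', m) := tm_trans q s in
  (q', move_head m (l, s', r)).

Definition tm_init (T : turing_machine) (w : seq bool) :
    tm_state T * tape (tm_work T) :=
  let w' : seq (symbol (tm_work T)) := [seq Some (inl b) | b <- w] in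
  (tm_start T, ([::], head None w', behead w')).

Definition tm_halts (T : turing_machine) (w : seq bool) : Prop :=
  exists t, (iter t (@tm_step T) (tm_init T w)).1 = tm_stop T.

(** [M], a subset of [dom], is semi-decidable: objects are given to the machine
    through descriptions [d] written as words, and the machine has to give the
    right answer on every description of every object of [dom]. *)
Definition semi_decidable (D T : Type) (word : D -> seq bool)
    (describes : D -> T -> Prop) (dom M : set T) : Prop :=
  (M `<=` dom)%classic /\
  exists tm : turing_machine, forall (d : D) (o : T), dom o -> describes d o ->
    (M o -> tm_halts tm (word d)) /\ (~ M o -> ~ tm_halts tm (word d)).

Record seq_prog := SeqProg { num_prog : prog; den_prog : prog; sgn_prog : prog }.

Definition describes_seq (d : seq_prog) (r : nat -> rat) : Prop :=
  exists a b s : nat -> nat,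
    [/\ computes (num_prog d) a, computes (den_prog d) b,
        computes (sgn_prog d) s, forall k, b k <> 0%N
      & forall k, r k = (-1) ^+ s k * (a k)%:R / (b k)%:R].

Definition describes_real (R : realType) (d : seq_prog) (x : R) : Prop :=
  exists2 r : nat -> rat, describes_seq d r
    & forall k, `|x - ratr (r k)| < 2 ^- k.

Definition computable_real (R : realType) (x : R) : Prop :=
  exists d : seq_prog, describes_real d x.

Definition nat_word (k : nat) : seq bool := rcons (nseq k true) false.

Definition seq_prog_word (d : seq_prog) : seq bool :=
  nat_word (gnum (num_prog d)) ++ nat_word (gnum (den_prog d))
    ++ nat_word (gnum (sgn_prog d)).

Definition log2 (R : realType) (x : R) : R := ln x / ln 2.

Definition complex_mx (R : realType) (n : nat) (A : 'M[R]_n) : 'M[R[i]]_n :=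
  map_mx (real_complex R) A.

Definition unstable (R : realType) (n : nat) (A : 'M[R]_n) : Prop :=
  exists2 l : R[i], eigenvalue (complex_mx A) l & 1 <= ComplexField.Normc.normc l.

Definition plant (R : realType) (n : nat) : set 'M[R]_n :=
  fun A => (forall i j, computable_real (A i j)) /\ unstable A.

Definition eigenvalues (R : realType) (n : nat) (A : 'M[R]_n) : seq R[i] :=
  sval (closed_field_poly_normal (char_poly (complex_mx A))).

Definition eta (R : realType) (n : nat) (A : 'M[R]_n) : R :=
  \sum_(l <- eigenvalues A | 1 <= ComplexField.Normc.normc l)
    log2 (ComplexField.Normc.normc l).

Definition is_distribution (R : realType) (X : finType) (P : X -> R) : Prop :=
  (forall x, 0 <= P x) /\ \sum_x P x = 1.

(** [W x y] is the transition probability W(y|x). *)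
Definition channel (R : realType) (X Y : finType) : set (X -> Y -> R) :=
  fun W => forall x, is_distribution (W x) /\ forall y, computable_real (W x y).

Definition channel_pow (R : realType) (X Y : finType) (W : X -> Y -> R)
    (m : nat) (x : m.-tuple X) (y : m.-tuple Y) : R :=
  \prod_(j < m) W (tnth x j) (tnth y j).

Definition orthogonal_words (R : realType) (X Y : finType) (W : X -> Y -> R)
    (m : nat) (x x' : m.-tuple X) : bool :=
  \sum_(y : m.-tuple Y) channel_pow W x y * channel_pow W x' y == 0.

Definition max_code (R : realType) (X Y : finType) (W : X -> Y -> R)
    (m : nat) : nat :=
  \max_(S : {set m.-tuple X} |
        [forall x in S, forall x' in S, (x != x') ==> orthogonal_words W x x'])
    #|S|.

Definition C0 (R : realType) (X Y : finType) (W : X -> Y -> R) : \bar R :=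
  limn_einf (fun m => (m%:R^-1 * log2 (max_code W m)%:R)%:E).

Definition log2_inv (R : realType) (s : R) : \bar R :=
  if s == 0 then +oo%E else (log2 (1 / s))%:E.

(** The supremum over [P] is attained, hence a maximum, when [X] is nonempty. *)
Definition C0FB (R : realType) (X Y : finType) (W : X -> Y -> R) : \bar R :=
  if C0 W == 0%E then 0%E else
  ereal_sup [set \big[Order.min/+oo%E]_(y : Y)
                   log2_inv (\sum_(x | 0 < W x y) P x)
            | P in [set P : X -> R | is_distribution P]]%classic.

Definition pair_prog (n : nat) (X Y : finType) : Type :=
  (('I_n -> 'I_n -> seq_prog) * (X -> Y -> seq_prog))%type.

Definition pair_prog_word (n : nat) (X Y : finType) (d : pair_prog n X Y) :
    seq bool :=
  flatten [seq seq_prog_word (d.1 i j) | i <- enum 'I_n, j <- enum 'I_n]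
    ++ flatten [seq seq_prog_word (d.2 x y) | x <- enum X, y <- enum Y].

Definition describes_pair (R : realType) (n : nat) (X Y : finType)
    (d : pair_prog n X Y) (o : 'M[R]_n * (X -> Y -> R)) : Prop :=
  (forall i j, describes_real (d.1 i j) (o.1 i j)) /\
  (forall x y, describes_real (d.2 x y) (o.2 x y)).

Definition S_SE_FB_unsolvable (R : realType) (n : nat) (X Y : finType) :
    set ('M[R]_n * (X -> Y -> R)) :=
  [set AW | (@plant R n `*` @channel R X Y) AW
            /\ (C0FB AW.2 < (eta AW.1)%:E)%E]%classic.

(* Main.v *)
Require Import Defs.
From mathcomp Require Import all_boot all_order all_algebra.
From mathcomp Require Import all_classical all_reals all_analysis.
From mathcomp Require Import complex perm zify ring lra.
Import Defs.

(** The feedback capacity of a channel depends only on its support, and it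
    decreases when the support grows ([C0FB_le]).  Hence [C0FB W < eta A] holds
    exactly when some set [S] of pairs on which [W] is positive satisfies
    [C0FB (indicator S) < eta A] ([C0FB_lt_support]).  The sets [S] are finitely
    many, and positivity of a described real is semi-decidable ([pos_approx]),
    so that [S] can be treated as fixed.

    For fixed [S] the capacity is 0, infinite, or the logarithm of the inverse
    of the value of a linear program with rational data.  By Fourier-Motzkin
    elimination such a value is attained and rational ([program_min_rat]), so
    that the inequality reads [p / q < M] with constants [p] and [q] and with
    [M] the product of the unstable eigenvalues of [A]
    ([C0FB_indicator_lt], [eta_mahler]).

    The quantity [M] is the Mahler measure of the characteristic polynomial, and
    it is bounded from below without computing eigenvalues.  If [A] has
    dimension [d] and eigenvalues [l], then [det (A^N - z)] is the product of
    the [l^N - z].  For integers [0 <= z <= d] its modulus is at most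
    [(d + 1)^d M^N], and for one of them it is at least [M^N / (4 d)^d], because
    [d] points cannot come close to [d + 1] integers.  Thus [c < M] holds exactly
    when [|det (A^N - z)| > (d + 1)^d c^N] for some [N] and [z]
    ([mahler_gt_det]).  This is an open condition on the entries of [A]; with an
    explicit modulus of continuity ([det_expr_close]) it can be witnessed on a
    rational approximation of [A] ([plant_test]).

    What remains is to let a Turing machine search for the witnesses.  Programs
    for counters, one of which reads the input, are run on a tape whose cells
    carry one mark per counter ([search_tm]).  The total functions that such
    programs compute are closed under primitive recursion, and the predicates
    [exists t, g t e <> 0] with [g] computable are closed under conjunction,
    disjunction, existential and bounded universal quantification
    ([semidec_tm]).  That a coded program terminates with a given value is such
    a predicate, the witness being a finite set of ranked judgements in which
    each one follows from others of lower rank ([eval_evalc],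
    [semidec_evalc]). *)

Set Implicit Arguments.
Unset Strict Implicit.
Unset Printing Implicit Defensive.

(** * Turing machines run counter programs *)

Definition store := nat -> nat.

Definition upd (s : store) (r v : nat) : store :=
  fun j => if j == r then v else s j.

Inductive test := Nonzero of nat | InputBit of nat.

Inductive cmd :=
| Inc of nat
| Dec of nat
| Seq of cmd & cmd
| While of test & cmd.

Definition test_true (w : seq bool) (s : store) (T : test) : bool :=
  match T with
  | Nonzero r => s r != 0
  | InputBit r => onth w (s r) == Some true
  end.

Inductive exec (w : seq bool) : cmd -> store -> store -> Prop :=
| exec_Inc r s : exec w (Inc r) s (upd s r (s r).+1)
| exec_Dec r s : exec w (Dec r) s (upd s r (s r).-1)
| exec_Seq c d s s1 s2 :
    exec w c s s1 -> exec w d s1 s2 -> exec w (Seq c d) s s2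
| exec_WhileF T c s : ~~ test_true w s T -> exec w (While T c) s s
| exec_WhileT T c s s1 s2 :
    test_true w s T -> exec w c s s1 -> exec w (While T c) s1 s2 ->
    exec w (While T c) s s2.

Definition test_reg (T : test) : nat :=
  match T with Nonzero r => r | InputBit r => r end.

Fixpoint max_reg (c : cmd) : nat :=
  match c with
  | Inc r | Dec r => r
  | Seq c d => maxn (max_reg c) (max_reg d)
  | While T c => maxn (test_reg T) (max_reg c)
  end.

(** The machines below never go left of the cell where they start, so that the
    tape is a function on [nat] and the left list is a reversed prefix of it. *)
Definition tape_at (W : finType) (t : tape W) (p : nat) (f : nat -> symbol W) :=
  [/\ t.1.1 = rev (mkseq f p), t.1.2 = f p
    & forall j, nth None t.2 j = f (p + j.+1)].

Section Tape.
Variable W : finType.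
Implicit Types (t : tape W) (f : nat -> symbol W).

Definition write (x : symbol W) t : tape W := (t.1.1, x, t.2).

Lemma tape_at_scan t p f : tape_at t p f -> t.1.2 = f p.
Proof. by case. Qed.

Lemma tape_at_right t p f :
  tape_at t p f -> tape_at (move_head MoveRight t) p.+1 f.
Proof.
case: t => [[l c] r] [/= -> -> hr]; split=> /=.
- by rewrite /mkseq -addn1 iotaD map_cat rev_cat.
- by rewrite -nth0 hr addn1.
- by move=> j; rewrite nth_behead hr addnS addSn.
Qed.

Lemma tape_at_left t p f :
  tape_at t p.+1 f -> tape_at (move_head MoveLeft t) p f.
Proof.
case: t => [[l c] r] [/= -> -> hr].
have -> : mkseq f p.+1 = rcons (mkseq f p) (f p).
  by rewrite /mkseq -addn1 iotaD map_cat cats1.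
rewrite rev_rcons /=; split=> //= -[|j] /=; first by rewrite addn1.
by rewrite hr addSnnS.
Qed.

Lemma tape_at_write t p f x :
  tape_at t p f -> tape_at (write x t) p (fun q => if q == p then x else f q).
Proof.
case: t => [[l c] r] [/= -> _ hr]; split=> /=; last 1 first.
- by move=> j; rewrite hr -[X in _ == X]addn0 eqn_add2l.
- congr rev; apply/eq_in_map => q; rewrite mem_iota /= add0n => hq.
  by rewrite ltn_eqF.
- by rewrite eqxx.
Qed.

Lemma tape_at_init (w : seq (symbol W)) :
  tape_at ([::], head None w, behead w) 0 (nth None w).
Proof.
by split=> // j; rewrite /= nth_behead.
Qed.

End Tape.

(** A piece of a Turing machine that control enters at [entry] and leaves with
    a Boolean answer, so that pieces can be plugged into each other. *)
Record machine (A : finType) := Machine {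
  state : finType;
  entry : state;
  trans : state -> symbol A -> (state + bool) * symbol A * move
}.

(** Only complete runs are recorded: a run of a piece that never leaves it
    relates no tapes. *)
Inductive runs (A : finType) (M : machine A) :
    state M -> tape A -> bool -> tape A -> Prop :=
| runs_exit q t b x mv :
    trans q t.1.2 = (inr b, x, mv) -> runs q t b (move_head mv (write x t))
| runs_step q t q' x mv b t' :
    trans q t.1.2 = (inl q', x, mv) ->
    runs q' (move_head mv (write x t)) b t' -> runs q t b t'.

Lemma runs_stay (A : finType) (M : machine A) (q q' : state M) t x b t' :
  trans q t.1.2 = (inl q', x, Stay) -> runs q' (write x t) b t' -> runs q t b t'.
Proof. exact: runs_step. Qed.

Definition machine_seq (A : finType) (M N : machine A) : machine A :=
  @Machine A (state M + state N)%type (inl (entry M)) (fun q x =>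
    match q with
    | inl q => let: (o, x', mv) := trans q x in
               (match o with
                | inl q' => inl (inl q')
                | inr _ => inl (inr (entry N)) end, x', mv)
    | inr q => let: (o, x', mv) := trans q x in
               (match o with
                | inl q' => inl (inr q')
                | inr b => inr b end, x', mv)
    end).

Definition machine_while (A : finType) (T M : machine A) : machine A :=
  @Machine A (state T + state M)%type (inl (entry T)) (fun q x =>
    match q with
    | inl q => let: (o, x', mv) := trans q x in
               (match o with
                | inl q' => inl (inl q')
                | inr true => inl (inr (entry M))
                | inr false => inr false end, x', mv)
    | inr q => let: (o, x', mv) := trans q x in
               (match o with
                | inl q' => inl (inr q')
                | inr _ => inl (inl (entry T)) end, x', mv)
    end).

Section Combinators.
Variables (A : finType) (M N : machine A).

Lemma runs_seq_r q t b t' :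
  runs (M := N) q t b t' -> runs (M := machine_seq M N) (inr q) t b t'.
Proof.
elim=> {q t b t'} [q t b x mv h|q t q' x mv b t' h _ IH].
  by apply: runs_exit; rewrite /= h.
by apply: (runs_step (M := machine_seq M N) (q' := inr q')) IH; rewrite /= h.
Qed.

Lemma runs_seq q t b t1 b' t' :
  runs (M := M) q t b t1 -> runs (entry N) t1 b' t' ->
  runs (M := machine_seq M N) (inl q) t b' t'.
Proof.
move=> h; elim: h b' t' => {q t b t1} [q t b x mv h|q t q' x mv b t1 h _ IH] b' t' hN.
  by apply: (runs_step (M := machine_seq M N) (q' := inr (entry N))) (runs_seq_r hN);
    rewrite /= h.
by apply: (runs_step (M := machine_seq M N) (q' := inl q')) (IH _ _ hN); rewrite /= h.
Qed.

Lemma runs_while_false q t t' :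
  runs (M := M) q t false t' -> runs (M := machine_while M N) (inl q) t false t'.
Proof.
move=> h; move eb: false h => b h.
elim: h eb => {q t b t'} [q t b x mv h|q t q' x mv b t1 h _ IH] eb.
  by rewrite -eb in h *; apply: runs_exit; rewrite /= h.
by apply: (runs_step (M := machine_while M N) (q' := inl q')) (IH eb); rewrite /= h.
Qed.

Lemma runs_while_body q t b t1 b' t' :
  runs (M := N) q t b t1 ->
  runs (M := machine_while M N) (inl (entry M)) t1 b' t' ->
  runs (M := machine_while M N) (inr q) t b' t'.
Proof.
move=> h; elim: h b' t' => {q t b t1} [q t b x mv h|q t q' x mv b t1 h _ IH] b' t' hN.
  by apply: (runs_step (M := machine_while M N) (q' := inl (entry M))) hN; rewrite /= h.
by apply: (runs_step (M := machine_while M N) (q' := inr q')) (IH _ _ hN); rewrite /= h.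
Qed.

Lemma runs_while_true q t t1 b' t' :
  runs (M := M) q t true t1 ->
  runs (M := machine_while M N) (inr (entry N)) t1 b' t' ->
  runs (M := machine_while M N) (inl q) t b' t'.
Proof.
move=> h; move eb: true h => b h.
elim: h b' t' eb => {q t b t1} [q t b x mv h|q t q' x mv b t1 h _ IH] b' t' eb hN.
  by rewrite -eb in h *; apply: (runs_step (M := machine_while M N) (q' := inr (entry N))) hN;
    rewrite /= h.
by apply: (runs_step (M := machine_while M N) (q' := inl q')) (IH _ _ eb hN); rewrite /= h.
Qed.

End Combinators.

(** A counter is a mark standing on the cell of its value.  Besides the marks
    of the counters [0, ..., m], a cell keeps the input letter that it held at
    the start and a flag that tells cell [0] from the others. *)
Definition cell (m : nat) : finType :=
  (option bool * bool * {ffun 'I_m.+1 -> bool})%type.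

Definition decode (m : nat) (x : symbol (cell m)) : cell m :=
  match x with
  | None => (None, false, [ffun=> false])
  | Some (inl b) => (Some b, false, [ffun=> false])
  | Some (inr y) => y
  end.

Definition set_mark (m : nat) (x : symbol (cell m)) (i : nat) (b : bool) :
    symbol (cell m) :=
  let: (inp, org, mk) := decode x in
  Some (inr (inp, org, [ffun j : 'I_m.+1 => if j == i :> nat then b else mk j])).

Definition has_mark (m : nat) (x : symbol (cell m)) (i : nat) : bool :=
  (decode x).2 (inord i).

Definition is_origin (m : nat) (x : symbol (cell m)) : bool := (decode x).1.2.

Definition is_one (m : nat) (x : symbol (cell m)) : bool :=
  (decode x).1.1 == Some true.

Inductive action := DoInc | DoDec | TestNonzero | TestInput.

(** States: [None] seeks the mark to the right, [Some None] puts the mark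
    down, [Some (Some b)] walks back to cell [0] with answer [b]. *)
Definition machine_action (m : nat) (a : action) (r : nat) : machine (cell m) :=
  @Machine (cell m) (option (option bool)) None (fun q x =>
    match q with
    | None =>
      if has_mark x r then
        match a with
        | DoInc => (inl (Some None), set_mark x r false, MoveRight)
        | DoDec => if is_origin x then (inr true, x, Stay)
                   else (inl (Some None), set_mark x r false, MoveLeft)
        | TestNonzero => (inl (Some (Some (~~ is_origin x))), x, Stay)
        | TestInput => (inl (Some (Some (is_one x))), x, Stay)
        end
      else (inl None, x, MoveRight)
    | Some None => (inl (Some (Some true)), set_mark x r true, Stay)
    | Some (Some b) =>
      if is_origin x then (inr b, x, Stay) else (inl (Some (Some b)), x, MoveLeft)
    end).

Section Counters.
Variables (m : nat) (w : seq bool).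
Implicit Types (s : store) (t : tape (cell m)) (f : nat -> symbol (cell m)).

Definition marked (mk : nat -> nat -> bool) f : Prop :=
  forall p, decode (f p) = (onth w p, p == 0, [ffun j : 'I_m.+1 => mk j p]).

Definition represents s f : Prop := marked (fun j p => s j == p) f.

Definition tape_store s t : Prop := exists2 f, tape_at t 0 f & represents s f.

Lemma represents_org s f p : represents s f -> is_origin (f p) = (p == 0).
Proof. by move=> h; rewrite /is_origin h. Qed.

Lemma represents_one s f p :
  represents s f -> is_one (f p) = (onth w p == Some true).
Proof. by move=> h; rewrite /is_one h. Qed.

Lemma represents_mark s f p r : r <= m ->
  represents s f -> has_mark (f p) r = (s r == p).
Proof. by move=> hr h; rewrite /has_mark h ffunE inordK. Qed.

Lemma write_scan t : write t.1.2 t = t.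
Proof. by case: t => [[]]. Qed.

Lemma runs_back a r s f t p b : represents s f -> tape_at t p f ->
  exists2 t', runs (M := machine_action m a r) (Some (Some b)) t b t'
            & tape_at t' 0 f.
Proof.
move=> hf; elim: p t => [|p IH] t ht.
  exists (move_head Stay (write t.1.2 t)).
    by apply: runs_exit; rewrite /= (tape_at_scan ht) (represents_org _ hf).
  by rewrite write_scan; case: t ht => [[]].
have [t' h1 h2] := IH (move_head MoveLeft t) (tape_at_left ht).
exists t' => //; rewrite -{1}(write_scan t) in h1; apply: runs_step h1.
by rewrite /= (tape_at_scan ht) (represents_org _ hf).
Qed.

(** Every action starts by walking from cell 0 to the mark of its counter. *)
Lemma runs_seek a r s f t b (Q : tape (cell m) -> Prop) : r <= m ->
  represents s f -> tape_at t 0 f ->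
  (forall t1, tape_at t1 (s r) f ->
     exists2 t', runs (M := machine_action m a r) None t1 b t' & Q t') ->
  exists2 t', runs (M := machine_action m a r) None t b t' & Q t'.
Proof.
move=> hr hf ht hQ.
suff H d p t1 : p + d = s r -> tape_at t1 p f ->
    exists2 t', runs (M := machine_action m a r) None t1 b t' & Q t'.
  exact: H (add0n _) ht.
elim: d p t1 => [|d IH] p t1 e h1; first by apply: hQ; rewrite -e addn0.
have [|t' h2 h3] := IH p.+1 (move_head MoveRight t1) _ (tape_at_right h1).
  by rewrite addSnnS.
exists t' => //; rewrite -{1}(write_scan t1) in h2; apply: runs_step h2.
by rewrite /= (tape_at_scan h1) (represents_mark _ hr hf) -e -[X in _ == X]addn0
           eqn_add2l.
Qed.

Lemma marked_set mk f r v b : marked mk f ->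
  marked (fun j p => if (j == r) && (p == v) then b else mk j p)
         (fun q => if q == v then set_mark (f v) r b else f q).
Proof.
move=> hf p; case: ifP => [/eqP ->|npv]; rewrite /set_mark hf.
  by congr (_, _, _); apply/ffunP => j; rewrite !ffunE andbT.
by congr (_, _, _); apply/ffunP => j; rewrite !ffunE andbF.
Qed.

Lemma eq_marked mk mk' f : (forall j p, mk j p = mk' j p) ->
  marked mk f -> marked mk' f.
Proof.
by move=> e hf p; rewrite hf; congr (_, _, _); apply/ffunP => j; rewrite !ffunE.
Qed.

Lemma runs_put a r mk f t p s : marked mk f -> tape_at t p f ->
  (forall j q, (if (j == r) && (q == p) then true else mk j q) = (s j == q)) ->
  exists2 t', runs (M := machine_action m a r) (Some None) t true t'
            & tape_store s t'.
Proof.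
move=> hf ht hs; have h1 := tape_at_write (set_mark (f p) r true) ht.
have h2 := eq_marked hs (marked_set r p true hf).
have [t' h3 h4] := runs_back a r true h2 h1.
exists t'; last by exists (fun q => if q == p then set_mark (f p) r true else f q).
by apply: runs_stay h3; rewrite /= (tape_at_scan ht).
Qed.

Lemma runs_Inc r s t : r <= m -> tape_store s t ->
  exists2 t', runs (entry (machine_action m DoInc r)) t true t'
            & tape_store (upd s r (s r).+1) t'.
Proof.
move=> hr [f ht hf]; apply: (runs_seek hr hf ht) => t1 h1.
have h2 := tape_at_right (tape_at_write (set_mark (f (s r)) r false) h1).
have h3 := marked_set r (s r) false hf.
have [|t' h4 h5] := runs_put DoInc (s := upd s r (s r).+1) (r := r) h3 h2.
  move=> j q; rewrite /upd; have [-> /=|//] := eqVneq j r.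
  by do 2?case: ifP; lia.
exists t' => //; apply: runs_step h4.
by rewrite /= (tape_at_scan h1) (represents_mark _ hr hf) eqxx.
Qed.

Lemma runs_Dec r s t : r <= m -> tape_store s t ->
  exists2 t', runs (entry (machine_action m DoDec r)) t true t'
            & tape_store (upd s r (s r).-1) t'.
Proof.
move=> hr [f ht hf]; apply: (runs_seek hr hf ht) => t1 h1.
case E: (s r) => [|v] /=.
  exists (move_head Stay (write t1.1.2 t1)).
    apply: runs_exit; rewrite /= (tape_at_scan h1) (represents_mark _ hr hf) eqxx.
    by rewrite (represents_org _ hf) E.
  exists f; first by rewrite write_scan; move: h1; rewrite E; case: (t1) => [[]].
  by apply: eq_marked hf => j p; rewrite /upd; have [->|//] := eqVneq j r; rewrite E.
rewrite E in h1.
have h2 := tape_at_left (tape_at_write (set_mark (f v.+1) r false) h1).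
have h3 := marked_set r v.+1 false hf.
have [|t' h4 h5] := runs_put DoDec (s := upd s r v) (r := r) h3 h2.
  move=> j q; rewrite /upd; have [-> /=|//] := eqVneq j r.
  by rewrite E; do 2?case: ifP; lia.
exists t' => //; apply: runs_step h4.
by rewrite /= (tape_at_scan h1) (represents_mark _ hr hf) E eqxx (represents_org _ hf).
Qed.

Definition machine_test (T : test) : machine (cell m) :=
  match T with
  | Nonzero r => machine_action m TestNonzero r
  | InputBit r => machine_action m TestInput r
  end.

Lemma runs_test T s t : test_reg T <= m -> tape_store s t ->
  exists2 t', runs (entry (machine_test T)) t (test_true w s T) t'
            & tape_store s t'.
Proof.
case: T => r /= hr [f ht hf]; apply: (runs_seek hr hf ht) => t1 h1.
  have [t' h2 h3] := runs_back TestNonzero r (s r != 0) hf h1.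
  exists t'; last by exists f.
  rewrite -{1}(write_scan t1) in h2; apply: runs_stay h2.
  by rewrite /= (tape_at_scan h1) (represents_mark _ hr hf) eqxx (represents_org _ hf).
have [t' h2 h3] := runs_back TestInput r (onth w (s r) == Some true) hf h1.
exists t'; last by exists f.
rewrite -{1}(write_scan t1) in h2; apply: runs_stay h2.
by rewrite /= (tape_at_scan h1) (represents_mark _ hr hf) eqxx (represents_one _ hf).
Qed.

Fixpoint compile (c : cmd) : machine (cell m) :=
  match c with
  | Inc r => machine_action m DoInc r
  | Dec r => machine_action m DoDec r
  | Seq c d => machine_seq (compile c) (compile d)
  | While T c => machine_while (machine_test T) (compile c)
  end.

Lemma runs_compile c s s' t : exec w c s s' -> max_reg c <= m -> tape_store s t ->
  exists b, exists2 t', runs (entry (compile c)) t b t' & tape_store s' t'.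
Proof.
move=> h; elim: h t => {c s s'} /=.
- by move=> r s t hr ht; exists true; apply: runs_Inc.
- by move=> r s t hr ht; exists true; apply: runs_Dec.
- move=> c d s s1 s2 _ IH1 _ IH2 t; rewrite geq_max => /andP[h1 h2] ht.
  have [b [t1 r1 ht1]] := IH1 t h1 ht; have [b' [t2 r2 ht2]] := IH2 t1 h2 ht1.
  by exists b', t2 => //; apply: runs_seq r1 r2.
- move=> T c s hT t; rewrite geq_max => /andP[h1 h2] ht.
  have [t1 r1 ht1] := runs_test h1 ht; exists false, t1 => //.
  by apply: runs_while_false; move: r1; rewrite (negbTE hT).
- move=> T c s s1 s2 hT _ IH1 _ IH2 t /[dup] h; rewrite geq_max => /andP[h1 h2] ht.
  have [t1 r1 ht1] := runs_test h1 ht; have [b [t2 r2 ht2]] := IH1 t1 h2 ht1.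
  have [b' [t3 r3 ht3]] := IH2 t2 h ht2; exists b', t3 => //.
  rewrite hT in r1; apply: runs_while_true r1 _; exact: runs_while_body r2 r3.
Qed.

End Counters.

(** The first step writes the marks of the counters, which all start at 0; the
    stop state is absorbing, so that a later return to the entry of [M]
    excludes an earlier halt. *)
Definition tm_repeat (m : nat) (M : machine (cell m)) : turing_machine :=
  @TuringMachine (option (option (state M))) (cell m) None (Some None) (fun q x =>
    match q with
    | None => (Some (Some (entry M)),
               Some (inr ((decode x).1.1, true, [ffun=> true])), Stay)
    | Some None => (q, x, Stay)
    | Some (Some q) =>
      let: (o, x', mv) := trans q x in
      (match o with
       | inl q' => Some (Some q')
       | inr true => Some None
       | inr false => Some (Some (entry M)) end, x', mv)
    end).

Section Repeat.
Variables (m : nat) (M : machine (cell m)).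
Let T := tm_repeat M.

Lemma iter_runs q t b t' : runs (M := M) q t b t' ->
  exists k, iter k.+1 (@tm_step T) (Some (Some q), t)
            = (if b then Some None else Some (Some (entry M)), t').
Proof.
elim=> {q t b t'} [q [[l x] r] b x' mv /= h|q [[l x] r] q' x' mv b t' /= h _ [k IH]].
  by exists 0; rewrite /= h; case: b h.
by exists k.+1; rewrite iterSr /= h.
Qed.

Lemma stop_absorbing (c : tm_state T * tape (tm_work T)) k :
  c.1 = Some None -> (iter k (@tm_step T) c).1 = Some None.
Proof.
by elim: k => //= k IH /IH; case: (iter _ _ _) => [q [[l x] r]] /= ->.
Qed.

(** If no round answers [true], the entry of [M] is reached at arbitrarily late
    times, which an absorbing stop state forbids after a halt. *)
Lemma tm_repeat_halts (w : seq bool) (G : nat -> bool)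
    (st : nat -> tape (cell m) -> Prop) :
  (forall t, tape_store w (fun=> 0) t -> st 0 t) ->
  (forall k t, st k t -> exists2 t', runs (entry M) t (G k) t' & st k.+1 t') ->
  tm_halts T w <-> exists k, G k.
Proof.
move=> st0 stS.
set c0 := tm_init T w.
have [t0 [e0 h0]] : exists t0, iter 1 (@tm_step T) c0 = (Some (Some (entry M)), t0) /\
    st 0 t0.
  rewrite /c0 /tm_init.
  set w' := [seq Some (inl b) | b <- w] : seq (symbol (cell m)).
  exists (write (Some (inr ((decode (head None w')).1.1, true, [ffun=> true])))
            ([::], head None w', behead w')); split=> //.
  apply: st0; eexists; first exact: tape_at_write (tape_at_init w').
  move=> p; case: eqP => [->|/eqP np] /=.
    rewrite /w'; case: (w) => [|b v] /=; congr (_, _, _);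
    by apply/ffunP => j; rewrite !ffunE.
  have -> : decode (nth None w' p) = (onth w p, false, [ffun=> false]).
    rewrite /w'; by elim: (w) p {np} => [|b v IH] [|p] //=.
  by congr (_, _, _); apply/ffunP => j; rewrite !ffunE eq_sym (negbTE np).
have loop k : (forall i, i < k -> ~~ G i) -> exists j t,
    k <= j /\ iter j (@tm_step T) c0 = (Some (Some (entry M)), t) /\ st k t.
  elim: k => [|k IH] hk; first by exists 1, t0.
  have [|j [t [hj [ej ht]]]] := IH; first by move=> i hi; apply: hk; apply: ltnW.
  have [t' r h] := stS k t ht; have [l el] := iter_runs r.
  exists (l.+1 + j), t'; split; first by lia.
  by rewrite iterD ej el (negbTE (hk _ (ltnSn k))).
split.
  case=> k hk; apply: contrapT => nG.
  have [|j [t [hj [ej _]]]] := loop k.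
    by move=> i _; apply/negP => Gi; apply: nG; exists i.
  have := stop_absorbing (j - k) hk.
  by rewrite -iterD subnK // ej.
case/ex_minnP => k Gk kmin.
have [|j [t [hj [ej ht]]]] := loop k.
  by move=> i hi; apply/negP => /kmin; lia.
have [t' r h] := stS k t ht; have [l el] := iter_runs r.
by exists (l.+1 + j); rewrite iterD ej el Gk.
Qed.

End Repeat.

(** Register 0 holds the current candidate and register 1 the verdict on it.
    The program itself always terminates: the only source of divergence is the
    search that repeats it. *)
Theorem search_tm (D : seq bool -> Prop) (c : cmd) (G : seq bool -> nat -> bool) :
  (forall w s, D w -> exists s', [/\ exec w c s s', s' 0 = (s 0).+1
                                   & (s' 1 != 0) = G w (s 0)]) ->
  exists T, forall w, D w -> tm_halts T w <-> exists k, G w k.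
Proof.
move=> hc; pose m := maxn (max_reg c) 1.
pose M := machine_seq (compile m c) (machine_test m (Nonzero 1)).
exists (tm_repeat M) => w Dw.
apply: (tm_repeat_halts (st := fun k t => exists2 s, s 0 = k & tape_store w s t)).
  by move=> t ht; exists (fun=> 0).
move=> k t [s <- ht]; have [s' [h1 h2 h3]] := hc w s Dw.
have [|b [t1 r1 ht1]] := runs_compile (m := m) h1 _ ht; first exact: leq_maxl.
have [|t2 r2 ht2] := runs_test (m := m) (T := Nonzero 1) _ ht1; first exact: leq_maxr.
by exists t2; [rewrite -h3; apply: runs_seq r1 r2 | exists s'].
Qed.

(** * Computable functions of an environment *)

Definition env := nat -> nat.

Definition scons (x : nat) (e : env) : env := fun i => if i is j.+1 then e j else x.

Notation "x .: e" := (scons x e) (at level 60, right associativity).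

Definition etail (e : env) : env := fun i => e i.+1.

(** A program works in the registers from [b] on, whatever they contain, and
    leaves the others as they were: programs are then composed by raising [b]. *)
Definition computable (g : env -> nat) : Prop :=
  forall (rho : nat -> nat) b, (forall i, rho i < b) ->
  exists c, forall w s, exists s',
    [/\ exec w c s s', forall j, j < b -> s' j = s j
      & s' b = g (fun i => s (rho i))].

Definition clear r := While (Nonzero r) (Dec r).
Definition transfer a r := While (Nonzero a) (Seq (Dec a) (Inc r)).

Ltac store_eq :=
  apply/funext => ?; rewrite /upd; repeat (case: eqP => ? //=; subst; rewrite ?eqxx //); try lia.

Lemma exec_clear w r s : exec w (clear r) s (upd s r 0).
Proof.
move e: (s r) => k; elim: k s e => [|k IH] s e.
  have -> : upd s r 0 = s by store_eq.
  by apply: exec_WhileF; rewrite /= e.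
apply: exec_WhileT (exec_Dec _ _ _) _; first by rewrite /= e.
have -> : upd s r 0 = upd (upd s r (s r).-1) r 0 by store_eq.
by apply: IH; rewrite /upd eqxx e.
Qed.

Lemma exec_transfer w a r s : a <> r ->
  exec w (transfer a r) s (upd (upd s r (s r + s a)) a 0).
Proof.
move=> ar; move e: (s a) => k; elim: k s e => [|k IH] s e.
  have -> : upd (upd s r (s r + 0)) a 0 = s by store_eq.
  by apply: exec_WhileF; rewrite /= e.
apply: exec_WhileT; first by rewrite /= e.
  exact: exec_Seq (exec_Dec _ _ _) (exec_Inc _ _ _).
set s1 := upd _ r _.
have -> : upd (upd s r (s r + k.+1)) a 0 = upd (upd s1 r (s1 r + k)) a 0.
  rewrite /s1; store_eq.
apply: IH; rewrite /s1 /upd eqxx; case: eqP => // _; lia.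
Qed.

(** Copying consumes the source; the second copy in [b.+1] restores it. *)
Definition copy a b :=
  Seq (Seq (clear b) (clear b.+1))
   (Seq (While (Nonzero a) (Seq (Dec a) (Seq (Inc b) (Inc b.+1))))
        (transfer b.+1 a)).

Lemma exec_copy w a b s : a < b -> exec w (copy a b) s (upd (upd s b (s a)) b.+1 0).
Proof.
move=> ab.
have H k s0 : s0 a = k -> exec w (While (Nonzero a) (Seq (Dec a) (Seq (Inc b) (Inc b.+1))))
     s0 (upd (upd (upd s0 b.+1 (s0 b.+1 + k)) b (s0 b + k)) a 0).
  elim: k s0 => [|k IH] s0 e.
    have -> : upd (upd (upd s0 b.+1 (s0 b.+1 + 0)) b (s0 b + 0)) a 0 = s0 by store_eq.
    by apply: exec_WhileF; rewrite /= e.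
  apply: exec_WhileT; first by rewrite /= e.
    exact: exec_Seq (exec_Dec _ _ _) (exec_Seq (exec_Inc _ _ _) (exec_Inc _ _ _)).
  set s1 := upd _ b.+1 _.
  have -> : upd (upd (upd s0 b.+1 (s0 b.+1 + k.+1)) b (s0 b + k.+1)) a 0 =
            upd (upd (upd s1 b.+1 (s1 b.+1 + k)) b (s1 b + k)) a 0.
    rewrite /s1; store_eq.
  by apply: IH; rewrite /s1 /upd !eqxx; do 2 (case: eqP => [|_]; first by lia); lia.
apply: exec_Seq; first exact: exec_Seq (exec_clear _ _ _) (exec_clear _ _ _).
apply: exec_Seq; first exact: (H _ _ erefl).
set s1 := upd _ a 0.
have -> : upd (upd s b (s a)) b.+1 0 = upd (upd s1 a (s1 a + s1 b.+1)) b.+1 0.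
  rewrite /s1; store_eq.
by apply: exec_transfer; lia.
Qed.

Lemma eq_computable f g : f =1 g -> computable f -> computable g.
Proof.
move=> fg hf rho b h; have [c hc] := hf rho b h.
by exists c => w s; have [s' [? ? ?]] := hc w s; exists s'; split; rewrite -?fg.
Qed.

Lemma computable_var i : computable (fun e => e i).
Proof.
move=> rho b h; exists (copy (rho i) b) => w s; eexists; split.
- exact: exec_copy.
- move=> j jb; rewrite /upd !ltn_eqF //; exact: leqW.
- by rewrite /upd eqxx ltn_eqF.
Qed.

Lemma computable_0 : computable (fun=> 0).
Proof.
move=> rho b h; exists (clear b) => w s; eexists; split.
- exact: exec_clear.
- by move=> j jb; rewrite /upd ltn_eqF.
- by rewrite /upd eqxx.
Qed.

Lemma computable_succ g : computable g -> computable (fun e => (g e).+1).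
Proof.
move=> hg rho b h; have [c hc] := hg rho b h.
exists (Seq c (Inc b)) => w s; have [s' [h1 h2 h3]] := hc w s.
eexists; split; first exact: exec_Seq h1 (exec_Inc _ _ _).
- by move=> j jb; rewrite /upd ltn_eqF // h2.
- by rewrite /upd eqxx h3.
Qed.

Lemma computable_ren (r : nat -> nat) g : computable g ->
  computable (fun e => g (fun i => e (r i))).
Proof. by move=> hg rho b h; apply: (hg (fun i => rho (r i)) b). Qed.

(** The value of [g] becomes variable 0 of [f]: registers below [b] still hold
    the other variables, so that [f] can be run from register [b.+1] on. *)
Lemma computable_let f g : computable f -> computable g -> computable (fun e => f (g e .: e)).
Proof.
move=> hf hg rho b h; have [cg hcg] := hg rho b h.
have [|cf hcf] := hf (b .: rho) b.+1; first by case=> //= i; apply: leqW.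
exists (Seq cg (Seq cf (Seq (clear b) (transfer b.+1 b)))) => w s.
have [s1 [h1 h2 h3]] := hcg w s; have [s2 [h4 h5 h6]] := hcf w s1.
eexists; split.
- apply: exec_Seq h1 (exec_Seq h4 (exec_Seq (exec_clear _ _ _) _)).
  by apply: exec_transfer; lia.
- move=> j jb; rewrite /upd !ltn_eqF ?h5 ?h2 //; exact: leqW.
- rewrite /upd !eqxx ltn_eqF // gtn_eqF // h6; congr f; apply/funext => -[|i] /=.
    by rewrite h3.
  by rewrite h2.
Qed.

(** The loop keeps the counter in [b], the accumulator in [b.+1] and the number
    of rounds to go in [b.+2]. *)
Lemma computable_rec_head f h : computable f ->
  computable (fun e => h (e 0) (e 1) (etail (etail e))) ->
  computable (fun e => nat_rect (fun=> nat) (f (etail e)) (fun k y => h k y (etail e)) (e 0)).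
Proof.
move=> hf hh rho b hrho.
have [|cf hcf] := hf (fun i => rho i.+1) b.+1; first by move=> i; apply: leqW.
have [|ch hch] := hh (b .: b.+1 .: etail rho) b.+3.
  by case=> [|[|i]]; rewrite /= /etail; [lia | lia | have := hrho i.+1; lia].
pose body := Seq (Dec b.+2) (Seq ch (Seq (Seq (clear b.+1) (transfer b.+3 b.+1)) (Inc b))).
exists (Seq (clear b) (Seq cf (Seq (copy (rho 0) b.+2)
  (Seq (While (Nonzero b.+2) body) (Seq (clear b) (transfer b.+1 b)))))) => w s.
set e := fun i => s (rho i).
pose R := nat_rect (fun=> nat) (f (etail e)) (fun k y => h k y (etail e)).
have loop n k s0 : s0 b.+2 = n -> s0 b = k -> s0 b.+1 = R k ->
    (forall j, j < b -> s0 j = s j) ->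
    exists s', [/\ exec w (While (Nonzero b.+2) body) s0 s',
      forall j, j < b -> s' j = s j & s' b.+1 = R (k + n)].
  elim: n k s0 => [|n IH] k s0 en ek eR es.
    by exists s0; split; rewrite ?addn0 //; apply: exec_WhileF; rewrite /= en.
  pose s1 := upd s0 b.+2 (s0 b.+2).-1.
  have [s2 [h1 h2 h3]] := hch w s1.
  pose s3 := upd (upd (upd s2 b.+1 0) b.+1 (upd s2 b.+1 0 b.+1 + upd s2 b.+1 0 b.+3)) b.+3 0.
  pose s4 := upd s3 b (s3 b).+1.
  have e3 : s2 b.+3 = R k.+1.
    rewrite h3 /s1 /= /R /=; congr (h _ _ _).
    - by rewrite /upd /= ltn_eqF ?ek //; lia.
    - by rewrite /upd /= ltn_eqF ?eR //; lia.
    apply/funext => i; rewrite /etail /upd /=.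
    by have := hrho i.+1 => ?; rewrite ltn_eqF ?es //; lia.
  have below j : j < b -> s4 j = s j.
    move=> jb; rewrite /s4 /s3 /upd !ltn_eqF ?h2 /s1 /upd ?ltn_eqF ?es //; lia.
  have [|||s' [h4 h5 h6]] := IH k.+1 s4 _ _ _ below.
  - rewrite /s4 /s3 /upd; do !(case: eqP => [|_]; first by lia).
    by rewrite h2 // /s1 /upd eqxx en.
  - rewrite /s4 /s3 /upd eqxx; do !(case: eqP => [|_]; first by lia).
    rewrite h2 ?ltnS; last by lia.
    by rewrite /s1 /upd; case: eqP => [|_]; [lia | rewrite ek].
  - rewrite /s4 /s3 /upd !eqxx; do !(case: eqP => [|_]; first by lia).
    by rewrite e3.
  exists s'; split=> //; last by rewrite h6 addSnnS.
  apply: exec_WhileT h4; first by rewrite /= en.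
  apply: exec_Seq (exec_Dec _ _ _) (exec_Seq h1 (exec_Seq _ (exec_Inc _ _ _))).
  by apply: exec_Seq (exec_clear _ _ _) _; apply: exec_transfer; lia.
have [s2 [h1 h2 h3]] := hcf w (upd s b 0).
pose s3 := upd (upd s2 b.+2 (s2 (rho 0))) b.+3 0.
have below2 j : j < b -> s2 j = s j.
  by move=> jb; rewrite h2 /upd ?ltn_eqF //; lia.
have below j : j < b -> s3 j = s j.
  by move=> jb; rewrite /s3 /upd !ltn_eqF ?below2 //; lia.
have [|||s4 [h4 h5 h6]] := loop (e 0) 0 s3 _ _ _ below.
- by rewrite /s3 /upd eqxx ltn_eqF // below2.
- rewrite /s3 /upd !ltn_eqF ?h2 /upd ?eqxx //; lia.
- rewrite /s3 /upd !ltn_eqF ?h3 /R /=; [|lia..].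
  congr f; apply/funext => i; rewrite /etail /e /upd ltn_eqF //.
eexists; split.
- apply: exec_Seq (exec_clear _ _ _) (exec_Seq h1 (exec_Seq _ (exec_Seq h4 _))).
    by apply: exec_copy; have := hrho 0; lia.
  by apply: exec_Seq (exec_clear _ _ _) _; apply: exec_transfer; lia.
- move=> j jb; rewrite /upd !ltn_eqF ?h5 //; lia.
- by rewrite /upd !eqxx ltn_eqF // gtn_eqF // h6.
Qed.

Lemma computable_shift g : computable g -> computable (fun e => g (etail e)).
Proof. exact: computable_ren. Qed.

Lemma computable_app1 F t : computable (fun e => F (e 0)) -> computable t ->
  computable (fun e => F (t e)).
Proof. by move=> hF ht; apply: (computable_let hF ht). Qed.

(** Closure properties are stated for arbitrary computable arguments, so that
    they chain by plain application. *)
Lemma computable_app2 F t u : computable (fun e => F (e 0) (e 1)) -> computable t ->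
  computable u ->
  computable (fun e => F (t e) (u e)).
Proof.
move=> hF ht hu.
have h1 := computable_ren (fun i => if i is _.+1 then 0 else 1) hF.
exact: (computable_let (computable_let h1 (computable_shift hu)) ht).
Qed.

Lemma computable_rec f h n : computable f -> computable n ->
  computable (fun e => h (e 0) (e 1) (etail (etail e))) ->
  computable (fun e => nat_rect (fun=> nat) (f e) (fun k y => h k y e) (n e)).
Proof. by move=> hf hn hh; apply: (computable_let (computable_rec_head hf hh) hn). Qed.

Lemma computable_const k : computable (fun=> k).
Proof. by elim: k => [|k IH]; [exact: computable_0 | exact: (computable_succ IH)]. Qed.

Lemma computable_add t u : computable t -> computable u -> computable (fun e => t e + u e).
Proof.
apply: computable_app2; apply: eq_computable (computable_rec (h := fun _ y _ => y.+1) (computable_var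
  0) (computable_var 1) _).
  by move=> e; elim: (e 1) => [|k /= ->]; rewrite ?addn0 ?addnS.
exact: computable_succ (computable_var 1).
Qed.

Lemma computable_mul t u : computable t -> computable u -> computable (fun e => t e * u e).
Proof.
apply: computable_app2.
apply: eq_computable (computable_rec (h := fun _ y e => y + e 0) computable_0 (computable_var 1) _).
  by move=> e; elim: (e 1) => [|k /= ->]; rewrite ?muln0 ?mulnS // addnC.
exact: computable_add (computable_var 1) (computable_var 2).
Qed.

Lemma computable_exp t u : computable t -> computable u -> computable (fun e => t e ^ u e).
Proof.
apply: computable_app2.
apply: eq_computable (computable_rec (h := fun _ y e => y * e 0) (computable_const 1) (computable_var
  1) _).
  by move=> e; elim: (e 1) => [|k /= ->] //; rewrite expnS mulnC.
exact: computable_mul (computable_var 1) (computable_var 2).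
Qed.

Lemma computable_pred t : computable t -> computable (fun e => (t e).-1).
Proof.
apply: computable_app1; apply: eq_computable (computable_rec (h := fun k _ _ => k) computable_0
  (computable_var 0) _).
  by move=> e; case: (e 0).
exact: computable_var.
Qed.

Lemma computable_sub t u : computable t -> computable u -> computable (fun e => t e - u e).
Proof.
apply: computable_app2.
apply: eq_computable (computable_rec (h := fun _ y _ => y.-1) (computable_var 0) (computable_var 1) _).
  by move=> e; elim: (e 1) => [|k /= ->]; rewrite ?subn0 ?subnS.
exact: computable_pred (computable_var 1).
Qed.

Lemma computable_leq t u : computable t -> computable u ->
  computable (fun e => (t e <= u e) : nat).
Proof.
move=> ht hu; apply: eq_computable (computable_sub (computable_const 1) (computable_sub ht hu)) => e.
by rewrite -subn_eq0; case: (t e - u e).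
Qed.

Lemma computable_ltn t u : computable t -> computable u ->
  computable (fun e => (t e < u e) : nat).
Proof. by move=> ht; apply: computable_leq; apply: computable_succ. Qed.

Lemma computable_andb (t u : env -> bool) : computable t -> computable u ->
  computable (fun e => (t e && u e) : nat).
Proof.
move=> ht hu; apply: eq_computable (computable_mul ht hu) => e.
by case: (t e); case: (u e).
Qed.

Lemma computable_negb (t : env -> bool) : computable t -> computable (fun e => (~~ t e) : nat).
Proof.
by move=> ht; apply: eq_computable (computable_sub (computable_const 1) ht) => e; case: (t e).
Qed.

Lemma computable_eqn t u : computable t -> computable u ->
  computable (fun e => (t e == u e) : nat).
Proof.
move=> ht hu; apply: eq_computable (computable_andb (computable_leq ht hu) (computable_leq hu ht)) => e.
by rewrite eqn_leq.
Qed.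

Lemma computable_sum f n : computable (fun e => f (e 0) (etail e)) -> computable n ->
  computable (fun e => \sum_(i < n e) f i e).
Proof.
move=> hf hn; apply: eq_computable (computable_rec (h := fun k y e => y + f k e) computable_0 hn _).
  by move=> e; elim: (n e) => [|k /= ->]; rewrite ?big_ord0 ?big_ord_recr.
apply: computable_add (computable_var 1) _.
exact: (computable_ren (fun i => if i is j.+1 then j.+2 else 0) hf).
Qed.

Lemma computable_prod f n : computable (fun e => f (e 0) (etail e)) -> computable n ->
  computable (fun e => \prod_(i < n e) f i e).
Proof.
move=> hf hn; apply: eq_computable (computable_rec (h := fun k y e => y * f k e) (computable_const 1)
  hn _).
  by move=> e; elim: (n e) => [|k /= ->]; rewrite ?big_ord0 ?big_ord_recr.
apply: computable_mul (computable_var 1) _.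
exact: (computable_ren (fun i => if i is j.+1 then j.+2 else 0) hf).
Qed.

Lemma computable_iter F n t : computable (fun e => F (e 0)) -> computable n -> computable t ->
  computable (fun e => iter (n e) F (t e)).
Proof.
move=> hF hn ht; apply: eq_computable (computable_rec (h := fun _ y _ => F y) ht hn _).
  by move=> e; elim: (n e) => //= k ->.
exact: (computable_ren (fun i => i.+1) hF).
Qed.

(** The root is obtained by counting, without unbounded search; it decodes
    [npair], since the root of [npair x y] is [x + y]. *)
Definition isqrt z := \sum_(i < z) (i.+1 ^ 2 <= z).
Definition nfst z := z - isqrt z ^ 2.
Definition nsnd z := isqrt z - nfst z.

Lemma isqrtP s z : s ^ 2 <= z < s.+1 ^ 2 -> isqrt z = s.
Proof.
move=> /andP[h1 h2]; rewrite /isqrt.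
transitivity (\sum_(i < z) (i < s)).
  apply: eq_bigr => i _; congr nat_of_bool; apply/idP/idP => h; last first.
    by apply: leq_trans h1; rewrite leq_exp2r.
  by rewrite -ltnS -(ltn_exp2r _ _ (isT : 0 < 2)) (leq_ltn_trans h).
have sz : s <= z by nia.
rewrite -(big_mkord xpredT (fun i => nat_of_bool (i < s))) (big_cat_nat (leq0n s) sz) /=.
rewrite big_nat (eq_bigr (fun=> 1)); last by move=> i /andP[_ ->].
rewrite -big_nat sum_nat_const_nat subn0 muln1 big_nat big1 ?addn0 // => i.
by case/andP => si _; rewrite ltnNge si.
Qed.

Lemma isqrt_npair x y : isqrt (npair x y) = x + y.
Proof. by apply: isqrtP; rewrite /npair; apply/andP; split; nia. Qed.

Lemma npairK1 x y : nfst (npair x y) = x.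
Proof. by rewrite /nfst isqrt_npair /npair; lia. Qed.

Lemma npairK2 x y : nsnd (npair x y) = y.
Proof. by rewrite /nsnd npairK1 isqrt_npair; lia. Qed.

Lemma npair_inj x y x' y' : npair x y = npair x' y' -> x = x' /\ y = y'.
Proof.
move=> e; split; first by rewrite -(npairK1 x y) e npairK1.
by rewrite -(npairK2 x y) e npairK2.
Qed.

Lemma computable_npair t u : computable t -> computable u ->
  computable (fun e => npair (t e) (u e)).
Proof.
move=> ht hu; exact: computable_add (computable_exp (computable_add ht hu) (computable_const
  2)) ht.
Qed.

Lemma computable_isqrt t : computable t -> computable (fun e => isqrt (t e)).
Proof.
apply: computable_app1; apply: (computable_sum (f := fun i e => i.+1 ^ 2 <= e 0))
  (computable_var 0).
apply: computable_leq (computable_exp (computable_succ (computable_var 0)) (computable_const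
  2)) (computable_var 1).
Qed.

Lemma computable_nfst t : computable t -> computable (fun e => nfst (t e)).
Proof. by move=> ht; apply: computable_sub ht (computable_exp (computable_isqrt ht)
  (computable_const 2)). Qed.

Lemma computable_nsnd t : computable t -> computable (fun e => nsnd (t e)).
Proof. by move=> ht; apply: computable_sub (computable_isqrt ht) (computable_nfst ht). Qed.

(** The code that [gnum] uses for the list of arguments of a composition. *)
Definition lcode (v : seq nat) : nat := foldr (fun x c => (npair x c).+1) 0 v.
Definition lhead c := if c is c'.+1 then nfst c' else 0.
Definition ltail c := if c is c'.+1 then nsnd c' else 0.
Definition lnth c i := lhead (iter i ltail c).

Lemma lheadK v : lhead (lcode v) = head 0 v.
Proof. by case: v => //= x v; rewrite npairK1. Qed.

Lemma ltailK v : ltail (lcode v) = lcode (behead v).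
Proof. by case: v => //= x v; rewrite npairK2. Qed.

Lemma lnthK v i : lnth (lcode v) i = nth 0 v i.
Proof.
rewrite /lnth; elim: i v => [|i IH] v; first by rewrite lheadK nth0.
by rewrite iterSr ltailK IH nth_behead.
Qed.

Lemma computable_lhead t : computable t -> computable (fun e => lhead (t e)).
Proof.
move=> ht; apply: eq_computable (computable_mul (computable_ltn computable_0 ht) (computable_nfst
  (computable_pred ht))) => e.
by case: (t e) => [|k]; rewrite /= ?mul1n.
Qed.

Lemma computable_ltail t : computable t -> computable (fun e => ltail (t e)).
Proof.
move=> ht; apply: eq_computable (computable_mul (computable_ltn computable_0 ht) (computable_nsnd
  (computable_pred ht))) => e.
by case: (t e) => [|k]; rewrite /= ?mul1n.
Qed.

Lemma computable_lnth t u : computable t -> computable u ->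
  computable (fun e => lnth (t e) (u e)).
Proof.
move=> ht hu; apply: computable_lhead; apply: computable_iter hu ht.
exact: computable_ltail (computable_var 0).
Qed.

(** A number codes the finite set of the positions of its binary ones. *)
Definition bit (S x : nat) : bool := odd (iter x half S).

Lemma computable_odd t : computable t -> computable (fun e => odd (t e)).
Proof.
apply: (computable_app1 (F := fun x => odd x));
  apply: eq_computable (computable_iter (F := fun b => 1 - b) _ (computable_var 0) computable_0).
  by move=> e; elim: (e 0) => //= k ->; case: (odd k).
exact: computable_sub (computable_const 1) (computable_var 0).
Qed.

Lemma computable_half t : computable t -> computable (fun e => half (t e)).
Proof.
apply: computable_app1.
apply: eq_computable (computable_rec (h := fun k y _ => odd k + y) computable_0 (computable_var 0) _).
  by move=> e; elim: (e 0) => //= k ->; rewrite uphalf_half.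
exact: computable_add (computable_odd (computable_var 0)) (computable_var 1).
Qed.

Lemma computable_bit t u : computable t -> computable u -> computable (fun e => bit (t e) (u e)).
Proof.
move=> ht hu; apply: computable_odd; apply: computable_iter hu ht;
  exact: computable_half (computable_var 0).
Qed.

Lemma bit0 x : bit 0 x = false.
Proof. by rewrite /bit; elim: x => //= x IH; rewrite -iterS iterSr. Qed.

Lemma bitS S x : bit S x.+1 = bit S./2 x.
Proof. by rewrite /bit iterSr. Qed.

Lemma bit_set (P : pred nat) n : exists S, forall x, bit S x = (x < n) && P x.
Proof.
elim: n P => [|n IH] P; first by exists 0 => x; rewrite bit0.
have [S hS] := IH (fun x => P x.+1).
exists (P 0 + S.*2) => -[|x]; first by rewrite /bit /= oddD odd_double addbF oddb.
by rewrite bitS half_bit_double ltnS -hS.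
Qed.

Lemma bit_lt S x : bit S x -> x < S.
Proof.
elim: x S => [|x IH] [|S] //; rewrite ?bit0 // bitS => /IH.
by rewrite /=; lia.
Qed.

(** * Semi-decidable predicates on environments *)

(** Witnesses [t] of [P] are recognized by a computable function; once [t] is
    large enough every larger one works too, so that the bounds of several
    witnesses can be merged. *)
Definition semidec (P : env -> Prop) : Prop :=
  exists g : nat -> env -> nat,
    [/\ computable (fun e => g (e 0) (etail e)),
        forall e t t', t <= t' -> g t e != 0 -> g t' e != 0
      & forall e, P e <-> exists t, g t e != 0].

Lemma eq_semidec P Q : (forall e, P e <-> Q e) -> semidec P -> semidec Q.
Proof.
move=> PQ [g [h1 h2 h3]]; exists g; split=> // e.
by rewrite -h3; split=> /PQ.
Qed.

Lemma semidec_bool (t : env -> bool) : computable t -> semidec t.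
Proof.
move=> ht; exists (fun _ e => nat_of_bool (t e)); split=> //; first exact: (computable_shift ht).
by move=> e; split=> [->|[_]]; [exists 0 | case: (t e)].
Qed.

Lemma semidec_and P Q : semidec P -> semidec Q -> semidec (fun e => P e /\ Q e).
Proof.
move=> [g [g1 g2 g3]] [h [h1 h2 h3]].
exists (fun t e => g t e * h t e); split; first exact: computable_mul.
  move=> e t t' tt'; rewrite !muln_eq0 !negb_or => /andP[gt ht].
  by rewrite (g2 _ _ _ tt' gt) (h2 _ _ _ tt' ht).
move=> e; rewrite g3 h3; split=> [[[t ht] [t' ht']]|[t]].
  exists (maxn t t'); rewrite muln_eq0 negb_or.
  by rewrite (g2 _ _ _ (leq_maxl t t') ht) (h2 _ _ _ (leq_maxr t t') ht').
by rewrite muln_eq0 negb_or => /andP[? ?]; split; exists t.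
Qed.

Lemma semidec_or P Q : semidec P -> semidec Q -> semidec (fun e => P e \/ Q e).
Proof.
move=> [g [g1 g2 g3]] [h [h1 h2 h3]].
exists (fun t e => g t e + h t e); split; first exact: computable_add.
  move=> e t t' tt'; rewrite !addn_eq0 !negb_and => /orP[gt|ht].
    by rewrite (g2 _ _ _ tt' gt).
  by rewrite (h2 _ _ _ tt' ht) orbT.
move=> e; rewrite g3 h3; split=> [[[t ht]|[t ht]]|[t]].
- by exists t; rewrite addn_eq0 negb_and ht.
- by exists t; rewrite addn_eq0 negb_and ht orbT.
- by rewrite addn_eq0 negb_and => /orP[?|?]; [left|right]; exists t.
Qed.

(** One parameter bounds both the search for [x] and the witness that [P x]
    needs; monotonicity makes this harmless. *)
Lemma semidec_ex (P : nat -> env -> Prop) : semidec (fun e => P (e 0) (etail e)) ->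
  semidec (fun e => exists x, P x e).
Proof.
move=> [g [g1 g2 g3]].
have E e t : \sum_(x < t) g t (x .: e) != 0 <-> exists2 x, x < t & g t (x .: e) != 0.
  rewrite sum_nat_eq0 negb_forall; split=> [/existsP[x] /= ?|[x xt h]].
    by exists x.
  by apply/existsP; exists (Ordinal xt).
exists (fun t e => \sum_(x < t) g t (x .: e)); split.
- apply: (computable_sum (f := fun x e => g (e 0) (x .: etail e))) (computable_var 0).
  apply: eq_computable (computable_ren (fun i => if i is j.+1 then (if j is k.+1 then k.+2 else 0)
    else 1) g1).
  by move=> e; congr g; apply/funext => -[].
- move=> e t t' tt' /E [x xt h]; apply/E; exists x; first exact: leq_trans tt'.
  exact: g2 h.
- move=> e; split=> [[x]|[t /E[x _ h]]].
    move=> /(g3 (x .: e))[t ht]; exists (maxn t x.+1); apply/E.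
    by exists x; [exact: leq_maxr | apply: g2 ht; exact: leq_maxl].
  by exists x; apply/(g3 (x .: e)); exists t.
Qed.

(** Finitely many witnesses are replaced by their maximum. *)
Lemma semidec_ball (P : nat -> env -> Prop) n :
  semidec (fun e => P (e 0) (etail e)) -> computable n ->
  semidec (fun e => forall x, x < n e -> P x e).
Proof.
move=> [g [g1 g2 g3]] hn.
have E e t : \prod_(x < n e) g t (x .: e) != 0 <-> forall x, x < n e -> g t (x .: e) != 0.
  elim: (n e) => [|k IH]; first by rewrite big_ord0.
  rewrite big_ord_recr muln_eq0 negb_or; split=> [/andP[/IH h hk] x|h].
    by rewrite ltnS leq_eqVlt => /orP[/eqP ->|/h].
  by rewrite h // andbT; apply/IH => x xk; apply: h; apply: ltnW.
exists (fun t e => \prod_(x < n e) g t (x .: e)); split.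
- apply: (computable_prod (f := fun x e => g (e 0) (x .: etail e))) (computable_shift hn).
  apply: eq_computable (computable_ren (fun i => if i is j.+1 then (if j is k.+1 then k.+2 else 0)
    else 1) g1).
  by move=> e; congr g; apply/funext => -[].
- move=> e t t' tt' /E h; apply/E => x xn; exact: g2 (h x xn).
- move=> e; split=> [h|[t /E h] x xn]; last by apply/(g3 (x .: e)); exists t; apply: h.
  suff [t ht] : exists t, forall x, x < n e -> g t (x .: e) != 0 by exists t; apply/E.
  elim: (n e) h => [|k IH] h; first by exists 0.
  have [|t ht] := IH; first by move=> x xk; apply: h; apply: ltnW.
  have /(g3 (k .: e))[t' ht'] := h k (ltnSn k).
  exists (maxn t t') => x; rewrite ltnS leq_eqVlt => /orP[/eqP ->|xk].
    by apply: g2 ht'; exact: leq_maxr.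
  by apply: g2 (ht x xk); exact: leq_maxl.
Qed.

Lemma semidec_ren (r : nat -> nat) P : semidec P -> semidec (fun e => P (fun i => e (r i))).
Proof.
move=> [g [g1 g2 g3]]; exists (fun t e => g t (fun i => e (r i))); split=> //.
- apply: eq_computable (computable_ren (fun i => if i is j.+1 then (r j).+1 else 0) g1) => e.
  by [].
- by move=> e; apply: g2.
Qed.

Lemma semidec_let (P : env -> Prop) t : semidec P -> computable t ->
  semidec (fun e => P (t e .: e)).
Proof.
move=> [g [g1 g2 g3]] ht; exists (fun k e => g k (t e .: e)); split=> //.
- have h := computable_ren (fun i => if i is j.+1 then (if j is k.+1 then k.+2 else 0) else 1) g1.
  apply: eq_computable (computable_let h (computable_shift ht)) => e.
  by congr g; apply/funext => -[].
- by move=> e; apply: g2.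
Qed.

Lemma semidec_app3 (P : nat -> nat -> nat -> Prop) t u v :
  semidec (fun e => P (e 0) (e 1) (e 2)) -> computable t -> computable u -> computable v ->
  semidec (fun e => P (t e) (u e) (v e)).
Proof.
move=> hP ht hu hv.
have h := semidec_ren (fun i => nth 0 [:: 2; 1; 0] i) hP.
exact: (semidec_let (semidec_let (semidec_let h (computable_shift (computable_shift hv)))
  (computable_shift hu)) ht).
Qed.

Lemma semidec_all_seq (T : Type) (l : seq T) (P : T -> env -> Prop) :
  (forall x, semidec (P x)) -> semidec (fun e => foldr (fun x Q => P x e /\ Q) True l).
Proof.
move=> h; elim: l => [|x l IH] /=; last exact: semidec_and.
apply: eq_semidec (semidec_bool (t := fun=> true) (computable_const 1)) => e; by split.
Qed.

Lemma semidec_any_seq (T : Type) (l : seq T) (P : T -> env -> Prop) :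
  (forall x, semidec (P x)) -> semidec (fun e => foldr (fun x Q => P x e \/ Q) False l).
Proof.
move=> h; elim: l => [|x l IH] /=; last exact: semidec_or.
apply: eq_semidec (semidec_bool (t := fun=> false) computable_0) => e; by split.
Qed.

Lemma semidec_all (T : finType) (P : T -> env -> Prop) :
  (forall x, semidec (P x)) -> semidec (fun e => forall x, P x e).
Proof.
move=> h; apply: eq_semidec (semidec_all_seq (enum T) h) => e.
have E l : foldr (fun x Q => P x e /\ Q) True l <-> forall x, x \in l -> P x e.
  elim: l => [|x l IH] //=; split=> [[hx /IH hl] y|hl].
    by rewrite inE => /orP[/eqP ->|/hl].
  split; first by apply: hl; exact: mem_head.
  by apply/IH => y yl; apply: hl; rewrite inE yl orbT.
rewrite E; split=> hl x; last by move=> _; apply: hl.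
by apply: hl; rewrite mem_enum.
Qed.

Lemma semidec_any (T : finType) (P : T -> env -> Prop) :
  (forall x, semidec (P x)) -> semidec (fun e => exists x, P x e).
Proof.
move=> h; apply: eq_semidec (semidec_any_seq (enum T) h) => e.
have E l : foldr (fun x Q => P x e \/ Q) False l <-> exists2 x, x \in l & P x e.
  elim: l => [|x l IH] //=; first by split=> // -[].
  rewrite IH; split=> [[hx|[y yl hy]]|[y]].
  - by exists x => //; exact: mem_head.
  - by exists y => //; rewrite inE yl orbT.
  - by rewrite inE => /orP[/eqP ->|yl] hy; [left | right; exists y].
rewrite E; split=> [[x _ hx]|[x hx]]; exists x => //.
by rewrite mem_enum.
Qed.

(** * Machines for semi-decidable predicates *)

Definition word_of (l : seq nat) : seq bool := flatten [seq nat_word k | k <- l].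

Lemma word_of_inj : injective word_of.
Proof.
move=> a a'; have pos b : (0 < size (word_of b)) = (b != [::]).
  by case: b => //= k b; rewrite /word_of /= size_cat size_rcons.
have nw k k' u u' : nat_word k ++ u = nat_word k' ++ u' -> k = k' /\ u = u'.
  elim: k k' => [|k IH] [|k'] //=; first by case.
  by case=> /IH [-> ->].
elim: a a' => [|k a IH] [|k' a'] // E.
- by have := pos (k' :: a'); rewrite -E.
- by have := pos (k :: a); rewrite E.
- by move: E; rewrite /word_of /= => /nw[-> /IH ->].
Qed.

(** The last [Inc] skips the letter [false] that ends a block. *)
Definition read_block p r :=
  Seq (clear r) (Seq (While (InputBit p) (Seq (Inc p) (Inc r))) (Inc p)).

Lemma exec_read_block w1 k w2 p r s : p <> r -> s p = size w1 ->
  exec (w1 ++ nat_word k ++ w2) (read_block p r) s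
       (upd (upd s r k) p (size (w1 ++ nat_word k))).
Proof.
move=> pr sp; set w := _ ++ _.
have npr : (p == r) = false by apply/eqP.
have nrp : (r == p) = false by rewrite eq_sym.
have onth_w i : onth w (size w1 + i) = if i < k then Some true else if i == k then Some false
    else onth w (size w1 + i).
  rewrite /w onth_cat ltnNge leq_addr /= addKn /nat_word cat_rcons onth_cat size_nseq.
  case: ifP => ik; first by rewrite onth_nseq ik.
  by case: eqP => // ->; rewrite subnn.
have H n s0 : s0 p + n = size w1 + k -> s0 r + n = k ->
    exec w (While (InputBit p) (Seq (Inc p) (Inc r))) s0
      (upd (upd s0 r k) p (size w1 + k)).
  elim: n s0 => [|n IH] s0 ep er.
    have -> : upd (upd s0 r k) p (size w1 + k) = s0 by store_eq.
    apply: exec_WhileF; rewrite /= -[s0 p]addn0 ep onth_w ltnn eqxx //.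
  apply: exec_WhileT.
  - have e : s0 p = size w1 + (k - n.+1) by lia.
    by rewrite /= e onth_w; case: ifP => //; lia.
  - exact: exec_Seq (exec_Inc _ _ _) (exec_Inc _ _ _).
  set s1 := upd _ r _.
  have -> : upd (upd s0 r k) p (size w1 + k) = upd (upd s1 r k) p (size w1 + k).
    rewrite /s1; store_eq.
  by apply: IH; rewrite /s1 /upd !eqxx ?npr ?nrp; lia.
apply: exec_Seq (exec_clear _ _ _) _.
apply: exec_Seq; first by apply: (H k); rewrite /upd ?eqxx ?npr ?nrp; lia.
set s1 := upd _ p _.
have -> : upd (upd s r k) p (size (w1 ++ nat_word k)) = upd s1 p (s1 p).+1.
  have : size (w1 ++ nat_word k) = (size w1 + k).+1.
    by rewrite size_cat /nat_word size_rcons size_nseq addnS.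
  by move=> ->; rewrite /s1; store_eq.
exact: exec_Inc.
Qed.

Fixpoint read_blocks n :=
  if n is n'.+1 then Seq (read_blocks n') (read_block 2 (3 + n')) else clear 2.

Lemma exec_read_blocks l n s : n <= size l -> exists s',
  [/\ exec (word_of l) (read_blocks n) s s', s' 2 = size (word_of (take n l)),
      forall i, i < n -> s' (3 + i) = nth 0 l i & s' 0 = s 0].
Proof.
elim: n => [|n IH] hn.
  by exists (upd s 2 0); split; rewrite ?take0 //; exact: exec_clear.
have [|s1 [h1 h2 h3 h4]] := IH; first exact: ltnW.
have ew : word_of l = word_of (take n l) ++ nat_word (nth 0 l n) ++ word_of (drop n.+1 l).
  by rewrite -{1}(cat_take_drop n l) (drop_nth 0) // /word_of map_cat flatten_cat.
have := exec_read_block (nth 0 l n) (word_of (drop n.+1 l)) (r := 3 + n) _ h2.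
rewrite -ew => /(_ ltac:(lia)) h5.
eexists; split; first exact: exec_Seq h1 h5.
- rewrite /upd eqxx; congr (size _).
  by rewrite (take_nth 0) // /word_of map_rcons flatten_rcons.
- move=> i; rewrite ltnS leq_eqVlt => /orP[/eqP ->|hi]; rewrite /upd /=.
    by rewrite eqxx.
  by rewrite eqn_add2l ltn_eqF ?h3.
- by rewrite /upd.
Qed.

(** The input is read again for every candidate witness, which spares a
    separate initial phase.  Register 0 is the candidate, 1 the verdict, 2 the
    reading position, the numbers read start at 3, and register [3 + q] stays 0
    for the variables beyond the input. *)
Theorem semidec_tm (q : nat) (P : env -> Prop) : semidec P ->
  exists T, forall l, size l = q -> tm_halts T (word_of l) <-> P (nth 0 l).
Proof.
move=> [g [g1 g2 g3]].
pose rho i := if i is j.+1 then (if j < q then 3 + j else 3 + q) else 0.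
have [|c hc] := g1 rho (q + 4).
  by case=> [|i]; rewrite /rho; [lia | case: ifP; lia].
pose body := Seq (read_blocks q) (Seq (clear (3 + q))
  (Seq c (Seq (clear 1) (Seq (transfer (q + 4) 1) (Inc 0))))).
have [] := @search_tm (fun w => exists2 l, size l = q & w = word_of l) body
  (fun w k => `[< exists l, [/\ size l = q, w = word_of l & g k (nth 0 l) != 0] >]).
  move=> w s [l sl ->].
  have [|s1 [h1 h2 h3 h4]] := @exec_read_blocks l q s; first by rewrite sl.
  have [s2 [h5 h6 h7]] := hc (word_of l) (upd s1 (3 + q) 0).
  eexists; split.
  - apply: exec_Seq h1 (exec_Seq (exec_clear _ _ _) (exec_Seq h5 _)).
    apply: exec_Seq (exec_clear _ _ _) (exec_Seq _ (exec_Inc _ _ _)).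
    by apply: exec_transfer; lia.
  - by rewrite /upd /= [0 == _]ltn_eqF ?h6 /upd /= ?h4 //; lia.
  - have e1 : s2 (q + 4) = g (s 0) (nth 0 l).
      rewrite h7; congr g; first by rewrite /upd /= h4.
      apply/funext => i; rewrite /etail /rho; case: ifP => iq.
        by rewrite /upd eqn_add2l ltn_eqF // h3.
      by rewrite /upd eqxx nth_default // sl leqNgt iq.
    have n1 : (1 == q + 4) = false by lia.
    have n2 : (q + 4 == 1) = false by lia.
    rewrite /upd /= n1 n2.
    rewrite e1; apply/idP/asboolP => [h|]; first by exists l.
    move=> [l' [sl' el' h]].
    by rewrite (word_of_inj el').
move=> T hT; exists T => l sl; rewrite hT; last by exists l.
rewrite g3; split=> [[k /asboolP[l' [sl' el' h]]]|[k h]]; last first.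
  by exists k; apply/asboolP; exists l.
by exists k; rewrite (word_of_inj el').
Qed.

(** * Evaluation of coded programs *)

Scheme eval_mut := Minimality for eval Sort Prop
with evals_mut := Minimality for evals Sort Prop.

Definition judgement k f v y := npair k (npair f (npair v y)).

(** The derivation rules of [eval] ([k = 0]) and [evals] ([k = 1]) on codes,
    with the premises left to a parameter: it is instantiated with validity, with
    membership in a list and with membership in a certificate. *)
Definition rule (prior : nat -> nat -> nat -> nat -> Prop) (k f v y : nat) : Prop :=
  (k = 0 /\ (
     (f = npair 0 0 /\ y = 0) \/
     (f = npair 1 0 /\ y = (lhead v).+1) \/
     (exists i, f = npair 2 i /\ y = lnth v i) \/
     (exists g gs ws, f = npair 3 (npair g gs) /\ prior 1 gs v ws /\ prior 0 g ws y) \/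
     (exists g h v', f = npair 4 (npair g h) /\ v = (npair 0 v').+1 /\ prior 0 g v' y) \/
     (exists g h v' n z, f = npair 4 (npair g h) /\ v = (npair n.+1 v').+1 /\
        prior 0 f (npair n v').+1 z /\ prior 0 h (npair n (npair z v').+1).+1 y) \/
     (exists g, f = npair 5 g /\ prior 0 g (npair y v).+1 0 /\
        forall i, i < y -> exists w, prior 0 g (npair i v).+1 w.+1))) \/
  (k = 1 /\ (
     (f = 0 /\ y = 0) \/
     (exists g gs z zs, f = (npair g gs).+1 /\ y = (npair z zs).+1 /\
        prior 0 g v z /\ prior 1 gs v zs))).

Lemma rule_mono (D E : nat -> nat -> nat -> nat -> Prop) k f v y :
  (forall k f v y, D k f v y -> E k f v y) -> rule D k f v y -> rule E k f v y.
Proof.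
move=> DE [[-> H]|[-> H]]; [left|right]; split=> //.
  case: H => [?|[?|[?|[H|[H|[H|H]]]]]]; [tauto|tauto|tauto|..].
  - by case: H => g [gs [ws [? [? ?]]]]; do 3 right; left; exists g, gs, ws; auto.
  - by case: H => g [h [v' [? [? ?]]]]; do 4 right; left; exists g, h, v'; auto.
  - case: H => g [h [v' [n [z [? [? [? ?]]]]]]]; do 5 right; left.
    by exists g, h, v', n, z; auto 7.
  - case: H => g [? [? H]]; do 6 right; exists g; split=> //; split; first by auto.
    by move=> i /H[w hw]; exists w; auto.
case: H => [?|[g [gs [z [zs [? [? [? ?]]]]]]]]; [tauto|right].
by exists g, gs, z, zs; auto 6.
Qed.

Lemma gnum_Comp f gs :
  gnum (Comp f gs) = npair 3 (npair (gnum f) (lcode [seq gnum g | g <- gs])).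
Proof. by rewrite /=; congr (npair 3 (npair _ _)); elim: gs => //= g gs ->. Qed.

(** The universal quantifiers make a judgement on numbers that code nothing
    vacuously valid, so that soundness needs no well-formedness of codes. *)
Definition valid (k f v y : nat) : Prop :=
  if k is 0 then forall F V, gnum F = f -> lcode V = v -> eval F V y
  else forall Gs V, lcode [seq gnum g | g <- Gs] = f -> lcode V = v ->
       exists2 ws, lcode ws = y & evals Gs V ws.

Lemma gnum_cases F t c : gnum F = npair t c ->
  match F with
  | Zero => t = 0 /\ c = 0
  | Succ => t = 1 /\ c = 0
  | Proj i => t = 2 /\ c = i
  | Comp f gs => t = 3 /\ c = npair (gnum f) (lcode [seq gnum g | g <- gs])
  | Rec f g => t = 4 /\ c = npair (gnum f) (gnum g)
  | Mu f => t = 5 /\ c = gnum f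
  end.
Proof.
by case: F => [||i|f gs|f g|f]; rewrite ?gnum_Comp => /npair_inj[<- <-].
Qed.

Lemma rule_valid k f v y : rule valid k f v y -> valid k f v y.
Proof.
case=> [[-> H]|[-> H]] /=.
  move=> F V eF eV; case: H => [H|[H|[H|[H|[H|[H|H]]]]]].
  - case: H => ef ->; rewrite ef in eF;
    case: F eF (gnum_cases eF) => [||i|g gs|g h|g] _ [] // _ _.
    exact: eval_Zero.
  - case: H => ef ->; rewrite ef in eF;
    case: F eF (gnum_cases eF) => [||i|g gs|g h|g] _ [] // _ _.
    by rewrite -eV lheadK; exact: eval_Succ.
  - case: H => i0 [ef ->]; rewrite ef in eF.
    case: F eF (gnum_cases eF) => [||i|g gs|g h|g] _ [] // _ ->.
    by rewrite -eV lnthK; exact: eval_Proj.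
  - case: H => g0 [gs0 [ws [ef [h1 h2]]]]; rewrite ef in eF.
    case: F eF (gnum_cases eF) => [||i|g gs|g h|g] _ [] // _ /npair_inj[e1 e2].
    have [ws' ews h3] := h1 gs V (esym e2) eV.
    apply: eval_Comp h3 _; exact: h2.
  - case: H => g0 [h0 [v' [ef [ev h1]]]]; rewrite ef in eF.
    case: F eF (gnum_cases eF) => [||i|g gs|g h|g] _ [] // _ /npair_inj[e1 e2].
    rewrite -eV in ev; case: V ev {eV} => //= x V [/npair_inj[-> eV]].
    by apply: eval_Rec0; apply: h1.
  - case: H => g0 [h0 [v' [n [z [ef [ev [h1 h2]]]]]]]; rewrite ef in eF h1.
    case: F eF (gnum_cases eF) => [||i|g gs|g h|g] eF [] // _ /npair_inj[e1 e2].
    rewrite -eV in ev; case: V ev {eV} => //= x V [/npair_inj[-> eV]].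
    apply: (@eval_RecS _ _ _ _ z); first by apply: h1; rewrite //= eV.
    by apply: h2; rewrite //= eV.
  - case: H => g0 [ef [h1 h2]]; rewrite ef in eF.
    case: F eF (gnum_cases eF) => [||i|g gs|g h|g] _ [] // _ e1.
    have [w hw] : exists w, forall i, i < y -> valid 0 g0 (npair i v).+1 (w i).+1.
      have /choice [w hw] : forall i, exists wi, i < y -> valid 0 g0 (npair i v).+1 wi.+1.
        by move=> i; have [/h2[wi ?]|_] := ltnP i y; [exists wi | exists 0].
      by exists w.
    apply: (@eval_Mu _ _ _ w); first by move=> i hi; apply: hw => //=; rewrite eV.
    by apply: h1 => //=; rewrite eV.
move=> Gs V eG eV; case: H => [[ef ->]|[g0 [gs0 [z [zs [ef [-> [h1 h2]]]]]]]].
  by exists [::] => //; case: Gs eG => [|g Gs] /=; [move=> _; exact: evals_nil | rewrite ef].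
rewrite ef in eG; case: Gs eG => //= g Gs [/npair_inj[e1 e2]].
have [ws ews h3] := h2 _ _ e2 eV.
by exists (z :: ws); [rewrite /= ews | apply: evals_cons (h1 _ _ e1 eV) h3].
Qed.

Definition ranked r k f v y := npair r (judgement k f v y).

Definition prior_in (S : nat -> Prop) r k f v y : Prop :=
  exists r', r' < r /\ S (ranked r' k f v y).

(** The ranks exclude circular justifications, while leaving certificates
    closed under union. *)
Definition certificate (S : nat -> Prop) : Prop :=
  forall x, S x -> exists r k f v y, x = ranked r k f v y /\ rule (prior_in S r) k f v y.

Lemma ranked_inj r k f v y r' k' f' v' y' :
  ranked r k f v y = ranked r' k' f' v' y' -> [/\ r = r', k = k', f = f', v = v' & y = y'].
Proof.
by move=> /npair_inj[-> /npair_inj[-> /npair_inj[-> /npair_inj[-> ->]]]].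
Qed.

Lemma certificate_valid S r k f v y : certificate S -> S (ranked r k f v y) -> valid k f v y.
Proof.
move=> hS; elim/ltn_ind: r k f v y => r IH k f v y /hS.
move=> [r' [k' [f' [v' [y' [/ranked_inj[<- <- <- <- <-] h]]]]]].
apply: rule_valid; apply: rule_mono h => k1 f1 v1 y1 [r1 [lt_r1 h1]].
exact: IH lt_r1 _ _ _ _ h1.
Qed.

Definition in_seq (L : seq nat) (x : nat) : Prop := x \in L.

Definition listed (L : seq nat) k f v y : Prop := exists r, ranked r k f v y \in L.

Definition derivable k f v y : Prop :=
  exists2 L, certificate (in_seq L) & listed L k f v y.

Lemma certificate_cat L1 L2 : certificate (in_seq L1) -> certificate (in_seq L2) ->
  certificate (in_seq (L1 ++ L2)).
Proof.
move=> h1 h2 x; rewrite /in_seq mem_cat => /orP[/h1|/h2];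
  move=> [r [k [f [v [y [-> h]]]]]]; exists r, k, f, v, y; split=> //;
  apply: rule_mono h => ? ? ? ? [r' [? h']]; exists r'; split=> //;
  by rewrite /in_seq mem_cat h' ?orbT.
Qed.

Lemma listed_cat L1 L2 k f v y :
  listed L1 k f v y \/ listed L2 k f v y -> listed (L1 ++ L2) k f v y.
Proof. by case=> -[r h]; exists r; rewrite mem_cat h ?orbT. Qed.

(** The conclusion enters the certificate with a rank above all others. *)
Lemma listed_derivable L k f v y :
  certificate (in_seq L) -> rule (listed L) k f v y -> derivable k f v y.
Proof.
move=> hL h; pose R := (\sum_(x <- L) nfst x).+1.
have hR r k' f' v' y' : ranked r k' f' v' y' \in L -> r < R.
  by move=> hin; rewrite ltnS /R (big_rem _ hin) /= npairK1 leq_addr.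
exists (ranked R k f v y :: L); last by exists R; exact: mem_head.
move=> x; rewrite /in_seq inE => /orP[/eqP ->|/hL].
  exists R, k, f, v, y; split=> //; apply: rule_mono h => ? ? ? ? [r hr].
  by exists r; split; [exact: hR hr | rewrite /in_seq inE hr orbT].
move=> [r [k' [f' [v' [y' [-> h']]]]]]; exists r, k', f', v', y'; split=> //.
apply: rule_mono h' => ? ? ? ? [r' [? hr']]; exists r'; split=> //.
by rewrite /in_seq inE hr' orbT.
Qed.

Lemma derivable2 k1 f1 v1 y1 k2 f2 v2 y2 :
  derivable k1 f1 v1 y1 -> derivable k2 f2 v2 y2 ->
  exists L, [/\ certificate (in_seq L), listed L k1 f1 v1 y1 & listed L k2 f2 v2 y2].
Proof.
move=> [L1 c1 h1] [L2 c2 h2]; exists (L1 ++ L2); split; first exact: certificate_cat.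
  by apply: listed_cat; left.
by apply: listed_cat; right.
Qed.

Lemma derivable_all k f v y n :
  (forall i, i < n -> derivable (k i) (f i) (v i) (y i)) ->
  exists2 L, certificate (in_seq L) & forall i, i < n -> listed L (k i) (f i) (v i) (y i).
Proof.
elim: n => [|n IH] h; first by exists [::].
have [|L cL hL] := IH; first by move=> i hi; apply: h; apply: ltnW.
have [L' cL' hL'] := h n (ltnSn n).
exists (L ++ L'); first exact: certificate_cat.
move=> i; rewrite ltnS leq_eqVlt => /orP[/eqP ->|/hL hi]; apply: listed_cat; tauto.
Qed.

(** The certificates of the premises are merged; for [Mu] there is one for each
    value that the search rejects. *)
Lemma eval_derivable F V y : eval F V y -> derivable 0 (gnum F) (lcode V) y.
Proof.
pose P0 Gs V ws := derivable 1 (lcode [seq gnum g | g <- Gs]) (lcode V) (lcode ws).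
move: F V y; apply: (@eval_mut _ P0) => [v|v|i v|f gs v ws y _ h1 _ h2|f g v y _ h
  |f g k v y z _ h1 _ h2|f v k w _ h1 _ h2|v|g gs v y ys _ h1 _ h2].
- by apply: (@listed_derivable [::]) => //; left; split=> //; left.
- by apply: (@listed_derivable [::]) => //; left; split=> //; right; left; rewrite lheadK.
- apply: (@listed_derivable [::]) => //; left; split=> //; do 2 right; left; exists i.
  by rewrite lnthK.
- have [L [c l1 l2]] := derivable2 h1 h2; apply: (listed_derivable c); left; split=> //.
  do 3 right; left; exists (gnum f), (lcode [seq gnum g | g <- gs]), (lcode ws).
  by rewrite gnum_Comp.
- have [L c l] := h; apply: (listed_derivable c); left; split=> //.
  by do 4 right; left; exists (gnum f), (gnum g), (lcode v).
- have [L [c l1 l2]] := derivable2 h1 h2; apply: (listed_derivable c); left; split=> //.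
  by do 5 right; left; exists (gnum f), (gnum g), (lcode v), k, y.
- have [L1 c1 l1] := derivable_all (k := fun=> 0) (f := fun=> gnum f)
    (v := fun i => (npair i (lcode v)).+1) (y := fun i => (w i).+1) h1.
  have [L2 c2 l2] := h2; apply: (listed_derivable (certificate_cat c1 c2)); left; split=> //.
  do 6 right; exists (gnum f); split=> //; split; first by apply: listed_cat; right.
  by move=> i hi; exists (w i); apply: listed_cat; left; apply: l1.
- by apply: (@listed_derivable [::]) => //; right; split=> //; left.
- have [L [c l1 l2]] := derivable2 h1 h2; apply: (listed_derivable c); right; split=> //.
  by right; exists (gnum g), (lcode [seq gnum g | g <- gs]), y, (lcode ys).
Qed.

Lemma eval_functional f v y : eval f v y -> forall y', eval f v y' -> y = y'.
Proof.
pose P0 Gs V ws := forall ws', evals Gs V ws' -> ws = ws'.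
move: f v y; apply: (@eval_mut _ P0) => [v|v|i v|f gs v ws y _ h1 _ h2|f g v y _ h
  |f g k v y z _ h1 _ h2|f v k w h h1 h' h2|v|g gs v y ys _ h1 _ h2] y' E;
  inversion_clear E => //.
- by apply: h2; rewrite (h1 _ H).
- exact: h.
- by apply: h2; rewrite (h1 _ H).
- case: (ltngtP k y') => // lt.
  + by have := h2 _ (H _ lt).
  + by have := h1 _ lt _ H0.
- by rewrite (h1 _ H) (h2 _ H0).
Qed.

Lemma semidec_eq t u : computable t -> computable u -> semidec (fun e => t e = u e).
Proof.
move=> ht hu; apply: eq_semidec (semidec_bool (computable_eqn ht hu)) => e.
by split=> [/eqP|->].
Qed.

Lemma semidec_imply (b : env -> bool) P : computable b -> semidec P -> semidec (fun e => b e ->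
  P e).
Proof.
move=> hb hP; apply: eq_semidec (semidec_or (semidec_bool (computable_negb hb)) hP) => e.
by case: (b e); split=> //; [case | right; auto | left].
Qed.

Ltac cmp := repeat first
  [ apply: computable_const | apply: computable_var | apply: computable_npair | apply:
    computable_lnth
  | apply: computable_lhead | apply: computable_bit | apply: computable_succ | apply:
    computable_ltn ].
Ltac sig := repeat first
  [ apply: semidec_ex | apply: semidec_and | apply: semidec_or | apply: semidec_eq
  | apply: semidec_ball | apply: semidec_bool ]; rewrite /etail /=; cmp.

Definition in_bits (S x : nat) : Prop := bit S x.

Lemma semidec_rule : semidec (fun e => rule (prior_in (in_bits (e 0)) (e 1)) (e 2) (e 3) (e 4)
  (e 5)).
Proof. rewrite /rule /prior_in /in_bits /ranked /judgement; sig. Qed.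

Lemma semidec_certificate : semidec (fun e => certificate (in_bits (e 0))).
Proof.
apply: (@eq_semidec (fun e => forall x, x < e 0 -> bit (e 0) x ->
  exists r k f v y, x = ranked r k f v y /\ rule (prior_in (in_bits (e 0)) r) k f v y)).
  by move=> e; split=> h x hx; [apply: h (bit_lt hx) hx | apply: h].
apply: semidec_ball; last exact: computable_var.
apply: semidec_imply; first by rewrite /etail; cmp.
do 5 apply: semidec_ex; apply: semidec_and; first by rewrite /ranked /judgement; sig.
exact: (semidec_ren (fun i => nth 0 [:: 6; 4; 3; 2; 1; 0] i) semidec_rule).
Qed.

(** Only meaningful when [f] and [v] are codes of a program and of a list. *)
Definition evalc (f v y : nat) : Prop :=
  exists S, certificate (in_bits S) /\ exists r, bit S (ranked r 0 f v y).

Lemma semidec_evalc f v y : computable f -> computable v -> computable y ->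
  semidec (fun e => evalc (f e) (v e) (y e)).
Proof.
apply: semidec_app3; apply: semidec_ex; apply: semidec_and; first exact: semidec_certificate.
by rewrite /ranked /judgement; sig.
Qed.

Lemma eval_evalc F V y : evalc (gnum F) (lcode V) y <-> eval F V y.
Proof.
split=> [[S [cS [r hr]]]|/eval_derivable[L cL [r hr]]].
  exact: (certificate_valid cS hr).
have [S hS] := bit_set (fun x => x \in L) (\sum_(x <- L) x).+1.
have hSL : in_bits S = in_seq L.
  apply/funext => x; rewrite /in_bits /in_seq hS; congr is_true.
  case: (boolP (x \in L)) => hx; rewrite ?andbF // andbT ltnS.
  by rewrite (big_rem _ hx) /= leq_addr.
exists S; split; first by rewrite hSL.
by exists r; have : in_bits S (ranked r 0 (gnum F) (lcode V) y) by rewrite hSL.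
Qed.

Import Order.TTheory GRing.Theory Num.Theory.
Import ComplexField.Normc.
Local Open Scope ring_scope.

(** * The product of the unstable eigenvalues *)

Section Determinant.
Variable F : closedFieldType.

Lemma prod_sub_opp (s : seq F) w :
  \prod_(l <- s) (l - w) = (-1) ^+ size s * \prod_(l <- s) (w - l).
Proof.
elim: s => [|l s IH]; first by rewrite !big_nil mulr1.
by rewrite !big_cons IH /= exprS -opprB; ring.
Qed.

Lemma det_sub_scalar d (A : 'M[F]_d) (s : seq F) w :
  char_poly A = \prod_(l <- s) ('X - l%:P) ->
  \det (A - w%:M) = \prod_(l <- s) (l - w).
Proof.
move=> e.
have sz : size s = d.
  by have := size_char_poly A; rewrite e size_prod_XsubC => -[].
have <- : (-1) ^+ d * \det (w%:M - A) = \det (A - w%:M).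
  by rewrite -detZ scaleN1r opprB.
rewrite prod_sub_opp sz; congr (_ * _).
have -> : w%:M - A = map_mx (horner_eval w) (char_poly_mx A).
  apply/matrixP => i j; rewrite !mxE /horner_eval /= !hornerE.
  by case: eqP => _; rewrite !hornerE.
rewrite det_map_mx -/(char_poly A) e rmorph_prod.
by apply: eq_bigr => l _; rewrite /= /horner_eval !hornerE.
Qed.

(** [X^N - z] splits into factors [X - w], hence [A^N - z] into factors
    [A - w]; exchanging the two products puts [X^N - z] back together at each
    eigenvalue. *)
Lemma det_expr_sub d (A : 'M[F]_d.+1) (s : seq F) z N :
  char_poly A = \prod_(l <- s) ('X - l%:P) ->
  \det (A ^+ N.+1 - z%:M) = \prod_(l <- s) (l ^+ N.+1 - z).
Proof.
move=> e; have [r] := closed_field_poly_normal ('X^(N.+1) - z%:P).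
have -> : lead_coef ('X^(N.+1) - z%:P : {poly F}) = 1.
  by apply/eqP; exact: monicXnsubC.
rewrite scale1r => er.
have -> : A ^+ N.+1 - z%:M = horner_mx A ('X^(N.+1) - z%:P).
  by rewrite rmorphB rmorphXn /= horner_mx_X horner_mx_C.
rewrite er rmorph_prod.
have -> : \det (\prod_(w <- r) horner_mx A ('X - w%:P)) = \prod_(w <- r) \det (A - w%:M).
  elim: r {er} => [|w r IH]; first by rewrite !big_nil det1.
  by rewrite !big_cons det_mulmx IH rmorphB /= horner_mx_X horner_mx_C.
under eq_bigr do rewrite (det_sub_scalar _ e).
rewrite exchange_big /=; apply: eq_bigr => l _.
have -> : l ^+ N.+1 - z = ('X^(N.+1) - z%:P).[l] by rewrite !hornerE.
by rewrite er horner_prod; apply: eq_bigr => w _; rewrite !hornerE.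
Qed.

End Determinant.

Section Mahler.
Variable R : realType.
Implicit Types (s : seq R[i]).

Lemma normc_ge0 (x : R[i]) : 0 <= normc x.
Proof. by case: x => a b; exact: sqrtr_ge0. Qed.

Lemma normc_real (x : R) : normc (real_complex R x) = `|x|.
Proof. by rewrite /= expr0n addr0 sqrtr_sqr. Qed.

Lemma normc_prod s (f : R[i] -> R[i]) : normc (\prod_(l <- s) f l) = \prod_(l <- s) normc (f l).
Proof.
by elim: s => [|l s IH]; rewrite ?big_nil ?big_cons ?normc1 // normcM IH.
Qed.

Lemma normcX (x : R[i]) k : normc (x ^+ k) = normc x ^+ k.
Proof. by elim: k => [|k IH]; rewrite ?expr0 ?normc1 // !exprS normcM IH. Qed.

Lemma normc_nat k : normc (k%:R : R[i]) = k%:R.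
Proof. by rewrite -(rmorph_nat (real_complex R)) normc_real ger0_norm. Qed.

(** The Mahler measure of the polynomial with roots [s]; roots inside the unit
    disc count for 1. *)
Definition mahler s : R := \prod_(l <- s) Num.max 1 (normc l).

Lemma mahler_ge1 s : 1 <= mahler s.
Proof.
rewrite /mahler; elim: s => [|l s IH]; rewrite ?big_nil // big_cons.
by rewrite mulr_ege1 // le_max lexx.
Qed.

(** Factor by factor, [|l|^N + z <= (d + 1) max(1, |l|)^N]. *)
Lemma prod_shift_le s N z d : (z <= d)%N ->
  normc (\prod_(l <- s) (l ^+ N - z%:R)) <= d.+1%:R ^+ size s * mahler s ^+ N.
Proof.
move=> zd; rewrite normc_prod /mahler.
elim: s => [|l s IH]; first by rewrite !big_nil /= expr1n mulr1.
rewrite !big_cons /= exprMn exprS mulrACA; apply: ler_pM => //.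
- exact: normc_ge0.
- by apply: prodr_ge0 => *; exact: normc_ge0.
have m1 : 1 <= Num.max 1 (normc l) ^+ N by apply: exprn_ege1; rewrite le_max lexx.
have m2 : normc l ^+ N <= Num.max 1 (normc l) ^+ N.
  by apply: lerXn2r; rewrite ?nnegrE ?normc_ge0 ?le_max ?lexx ?orbT ?ler01.
apply: le_trans (le_normcD _ _) _; rewrite normcN normc_nat normcX.
have zd' : (z%:R : R) <= d%:R by rewrite ler_nat.
have d0 : 0 <= (d%:R : R) by [].
rewrite -natr1; nra.
Qed.

(** The open discs of radius 1/2 around the integers are disjoint, so that [d]
    points cannot meet [d + 1] of them. *)
Lemma integer_far s : exists2 z, (z <= size s)%N &
  forall l, l \in s -> 2^-1 <= normc (l - z%:R).
Proof.
apply: contrapT => H.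
have far (z : 'I_(size s).+1) : exists i : 'I_(size s), normc (s`_i - z%:R) < 2^-1.
  apply: contrapT => nz; apply: H; exists z; first by rewrite -ltnS.
  move=> l /(nthP 0)[i hi <-]; rewrite leNgt; apply/negP => h.
  by apply: nz; exists (Ordinal hi).
have [f hf] := choice far.
have inj_f : injective f.
  move=> z z' e; apply/val_inj => /=; apply/eqP/negPn/negP => nzz.
  have : normc (z%:R - z'%:R : R[i]) < 1.
    have -> : z%:R - z'%:R = (s`_(f z') - z'%:R) - (s`_(f z) - z%:R) :> R[i].
      by rewrite e; ring.
    apply: le_lt_trans (le_normcD _ _) _; rewrite normcN.
    have := hf z; have := hf z'; lra.
  have -> : z%:R - z'%:R = real_complex R (z%:R - z'%:R) by rewrite rmorphB !rmorph_nat.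
  rewrite normc_real; move: nzz; rewrite neq_ltn => /orP[] lt.
    rewrite distrC -natrB; last exact: ltnW.
    by rewrite ger0_norm // -[1]/(1%:R) ltr_nat ltnS leqn0 subn_eq0 leqNgt lt.
  rewrite -natrB; last exact: ltnW.
  by rewrite ger0_norm // -[1]/(1%:R) ltr_nat ltnS leqn0 subn_eq0 leqNgt lt.
by have := leq_card f inj_f; rewrite !card_ord ltnn.
Qed.

Lemma far_ge d z (l : R[i]) : (z <= d.+1)%N -> 2^-1 <= normc (l - z%:R) ->
  Num.max 1 (normc l) <= (4 * d.+1)%:R * normc (l - z%:R).
Proof.
move=> zd h.
have h2 : normc l <= normc (l - z%:R) + z%:R.
  by rewrite -[X in normc X <= _](subrK z%:R) -(normc_nat z) le_normcD.
have zd' : (z%:R : R) <= d.+1%:R by rewrite ler_nat.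
have d1 : 1 <= (d.+1%:R : R) by rewrite ler1n.
rewrite natrM ge_max; apply/andP; split; nra.
Qed.

Lemma prod_far_ge s N d : size s = d.+1 -> exists2 z, (z <= d.+1)%N &
  mahler s ^+ N.+1 <= (4 * d.+1)%:R ^+ d.+1 * normc (\prod_(l <- s) (l ^+ N.+1 - z%:R)).
Proof.
move=> sz; have [z] := integer_far [seq l ^+ N.+1 | l <- s].
rewrite size_map sz => zd hz; exists z => //.
rewrite normc_prod /mahler -[X in _ ^+ X * _]sz -prodrXl.
have : forall l, l \in s -> 2^-1 <= normc (l ^+ N.+1 - z%:R).
  by move=> l hl; apply: hz; exact: map_f.
elim: (s) => [|l t IH] ht; first by rewrite !big_nil expr0 mulr1.
rewrite !big_cons /= [_ ^+ (size t).+1]exprS mulrACA; apply: ler_pM.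
- by apply: exprn_ge0; rewrite le_max ler01.
- by apply: prodr_ge0 => *; apply: exprn_ge0; rewrite le_max ler01.
- apply: le_trans (far_ge zd (ht l (mem_head _ _))).
  rewrite normcX; have [|lt1] := leP 1 (normc l); first by rewrite le_max lexx orbT.
  by rewrite expr1n le_max lexx.
by apply: IH => l' hl'; apply: ht; rewrite inE hl' orbT.
Qed.

Lemma bernoulli_unbounded (x K : R) : 1 < x -> exists N, K < x ^+ N.+1.
Proof.
move=> x1; have B N : 1 + N%:R * (x - 1) <= x ^+ N.
  elim: N => [|N IH]; first by rewrite mul0r addr0 expr0.
  have p : 0 <= (N%:R : R) * (x - 1) ^+ 2 by rewrite mulr_ge0 ?sqr_ge0.
  rewrite exprS -natr1; nra.
exists (Num.truncn (K / (x - 1))); apply: lt_le_trans (B _).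
have := truncnS_gt (K / (x - 1)); rewrite ltr_pdivrMr ?subr_gt0 //; lra.
Qed.

(** Up to constants that do not depend on [N], the largest of the determinants
    for [z <= d + 1] is the [N]-th power of the Mahler measure: integers far
    from all the [l^N] give the lower bound. *)
Lemma mahler_gt_det d (A : 'M[R]_d.+1) (c : R) : 0 < c ->
  c < mahler (eigenvalues A) <->
  exists N z, (z <= d.+1)%N /\
    d.+2%:R ^+ d.+1 * c ^+ N.+1 < `|\det (A ^+ N.+1 - z%:R%:M)|.
Proof.
move=> c0; set s := eigenvalues A.
have es : char_poly (complex_mx A) = \prod_(l <- s) ('X - l%:P).
  rewrite /s /eigenvalues; case: closed_field_poly_normal => r /= {1}->.
  by rewrite (eqP (char_poly_monic _)) scale1r.
have sz : size s = d.+1.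
  by have := size_char_poly (complex_mx A); rewrite es size_prod_XsubC => -[].
have detE N z : `|\det (A ^+ N.+1 - z%:R%:M)| = normc (\prod_(l <- s) (l ^+ N.+1 - z%:R)).
  rewrite -(det_expr_sub _ _ es) -normc_real -det_map_mx; congr (normc (\det _)).
  by rewrite map_mxB map_scalar_mx rmorphXn /= rmorph_nat.
have M1 := mahler_ge1 s; have M0 : 0 < mahler s by lra.
split=> [cM|[N [z [zd]]]].
  have [N hN] : exists N, (4 * d.+1)%:R ^+ d.+1 * d.+2%:R ^+ d.+1 < (mahler s / c) ^+ N.+1.
    by apply: bernoulli_unbounded; rewrite ltr_pdivlMr // mul1r.
  have [z zd hz] := prod_far_ge N sz; exists N, z; split=> //.
  rewrite detE; have K0 : 0 < (4 * d.+1)%:R ^+ d.+1 :> R by rewrite exprn_gt0 // ltr0n.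
  rewrite -(ltr_pM2l K0) mulrA; apply: lt_le_trans hz.
  by move: hN; rewrite expr_div_n ltr_pdivlMr // exprn_gt0.
rewrite detE => h; have := lt_le_trans h (prod_shift_le s N.+1 zd); rewrite sz.
by rewrite ltr_pM2l ?exprn_gt0 ?ltr0n // ltr_pXn2r ?nnegrE ?ltW.
Qed.

Lemma eta_mahler n (A : 'M[R]_n) : eta A = log2 (mahler (eigenvalues A)).
Proof.
rewrite /eta /mahler; elim: (eigenvalues A) => [|l s IH].
  by rewrite !big_nil /log2 ln1 mul0r.
rewrite !big_cons IH -/(mahler s); have M1 := mahler_ge1 s.
have [l1|l1] := leP 1 (normc l); last by rewrite mul1r.
rewrite /log2 lnM ?posrE ?mulrDl //; lra.
Qed.

End Mahler.

Section Perturbation.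
Variables (R : realFieldType) (d : nat).
Implicit Types A B : 'M[R]_d.+1.

Definition close_entries (e : R) A B := forall i j, `|A i j - B i j| <= e.
Definition bounded_entries (h : R) A := forall i j, `|A i j| <= h.

Lemma bounded_expr h A N : 1 <= h -> bounded_entries h A ->
  bounded_entries ((d.+1%:R * h) ^+ N) (A ^+ N).
Proof.
move=> h1 bA; elim: N => [|N IH] i j.
  by rewrite !expr0 mxE; case: eqP => _; rewrite /= ?normr1 ?normr0.
rewrite exprS mxE exprS -mulrA mulr_natl.
apply: le_trans (ler_norm_sum _ _ _) _; rewrite -[X in _ *+ X]card_ord -sumr_const.
by apply: ler_sum => k _; rewrite normrM; apply: ler_pM.
Qed.

Lemma close_expr h e A B N : 1 <= h -> 0 <= e ->
  bounded_entries h A -> bounded_entries h B -> close_entries e A B ->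
  close_entries (e * (2 * (d.+1%:R * h)) ^+ N) (A ^+ N) (B ^+ N).
Proof.
move=> h1 e0 bA bB cAB; set K := d.+1%:R * h.
have d1 : 1 <= (d.+1%:R : R) by rewrite ler1n.
have K1 : 1 <= K by rewrite /K mulr_ege1.
elim: N => [|N IH] i j; first by rewrite !expr0 subrr normr0 mulr1.
rewrite !exprS !mxE -sumrB.
apply: le_trans (ler_norm_sum _ _ _) _.
apply: (@le_trans _ _ (\sum_(k < d.+1) (h * (e * (2 * K) ^+ N) + e * K ^+ N))).
  apply: ler_sum => k _.
  have -> : A i k * (A ^+ N) k j - B i k * (B ^+ N) k j =
     A i k * ((A ^+ N) k j - (B ^+ N) k j) + (A i k - B i k) * (B ^+ N) k j by ring.
  apply: le_trans (ler_normD _ _) _; rewrite !normrM; apply: lerD; apply: ler_pM => //.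
  exact: bounded_expr.
rewrite sumr_const card_ord -[X in X <= _]mulr_natl.
have p1 : 0 <= K ^+ N by apply: exprn_ge0; lra.
have p2 : K ^+ N <= (2 * K) ^+ N by apply: lerXn2r; rewrite ?nnegrE; lra.
have p3 : d.+1%:R <= K by rewrite /K; nra.
have -> : d.+1%:R * (h * (e * (2 * K) ^+ N) + e * K ^+ N) =
  e * (K * (2 * K) ^+ N + d.+1%:R * K ^+ N) by rewrite /K; ring.
apply: ler_wpM2l => //; have : d.+1%:R * K ^+ N <= K * (2 * K) ^+ N by apply: ler_pM; lra.
lra.
Qed.

(** Replacing the factors one at a time. *)
Lemma prod_close n (p q : 'I_n -> R) G e : 1 <= G -> 0 <= e ->
  (forall i, `|p i| <= G) -> (forall i, `|q i| <= G) -> (forall i, `|p i - q i| <= e) ->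
  `|\prod_i p i - \prod_i q i| <= e * (2 * G) ^+ n.
Proof.
move=> G1 e0; elim: n p q => [|n IH] p q bp bq pq.
  by rewrite !big_ord0 subrr normr0 mulr1.
rewrite !big_ord_recl.
set P := \prod_(i < n) p _; set Q := \prod_(i < n) q _.
have -> : p ord0 * P - q ord0 * Q = p ord0 * (P - Q) + (p ord0 - q ord0) * Q by ring.
have hQ : `|Q| <= G ^+ n.
  rewrite /Q normr_prod -[X in _ ^+ X]card_ord -prodr_const; apply: ler_prod => i _.
  by rewrite normr_ge0 bq.
have hPQ : `|P - Q| <= e * (2 * G) ^+ n by apply: IH => i.
apply: le_trans (ler_normD _ _) _; rewrite !normrM.
have h1 : `|p ord0| * `|P - Q| <= G * (e * (2 * G) ^+ n) by apply: ler_pM.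
have h2 : `|p ord0 - q ord0| * `|Q| <= e * G ^+ n by apply: ler_pM.
have p2 : G ^+ n <= (2 * G) ^+ n by apply: lerXn2r; rewrite ?nnegrE; lra.
have p3 : G ^+ n <= G * (2 * G) ^+ n by rewrite -[X in X <= _]mul1r; apply: ler_pM;
  rewrite ?exprn_ge0; lra.
have p4 : e * G ^+ n <= e * (G * (2 * G) ^+ n) by apply: ler_wpM2l.
rewrite exprS; lra.
Qed.

Lemma det_close A B G e : 1 <= G -> 0 <= e ->
  bounded_entries G A -> bounded_entries G B -> close_entries e A B ->
  `|\det A - \det B| <= e * ((d.+1)`!%:R * (2 * G) ^+ d.+1).
Proof.
move=> G1 e0 bA bB cAB; rewrite /determinant -sumrB.
apply: le_trans (ler_norm_sum _ _ _) _.
have -> : e * ((d.+1)`!%:R * (2 * G) ^+ d.+1) = \sum_(s : {perm 'I_d.+1}) e * (2 * G) ^+ d.+1.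
  by rewrite sumr_const card_Sn -[RHS]mulr_natl; ring.
apply: ler_sum => s _; rewrite -mulrBr normrM normrX normrN1 expr1n mul1r.
by apply: prod_close.
Qed.

(** A Lipschitz constant of [A |-> det (A^N - z)], uniform in [z <= d + 1], on
    the matrices with entries bounded by [h]; it is a natural number so that it
    can be computed. *)
Definition det_modulus N h : nat :=
  ((d.+1)`! * (2 * ((d.+1 * h) ^ N + d.+1)) ^ d.+1 * (2 * (d.+1 * h)) ^ N)%N.

Lemma det_expr_close A B e N h z : 0 <= e -> (0 < h)%N -> (z <= d.+1)%N ->
  bounded_entries h%:R A -> bounded_entries h%:R B -> close_entries e A B ->
  `|\det (A ^+ N - z%:R%:M) - \det (B ^+ N - z%:R%:M)| <= e * (det_modulus N h)%:R.
Proof.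
move=> e0 h0 zd bA bB cAB.
have h1 : 1 <= h%:R :> R by rewrite ler1n.
set G : R := (d.+1%:R * h%:R) ^+ N + d.+1%:R.
have d1 : 1 <= d.+1%:R :> R by rewrite ler1n.
have zd' : z%:R <= d.+1%:R :> R by rewrite ler_nat.
have G1 : 1 <= G.
  have : 0 <= (d.+1%:R * h%:R : R) ^+ N by apply: exprn_ge0; nra.
  rewrite /G; lra.
have bG C : bounded_entries h%:R C -> bounded_entries G (C ^+ N - z%:R%:M).
  move=> bC i j; rewrite !mxE; apply: le_trans (ler_normB _ _) _.
  apply: lerD; first exact: bounded_expr.
  by case: eqP => _; rewrite ?mulr1n ?mulr0n ?normr0 // normr_nat.
apply: le_trans (det_close (e := e * (2 * (d.+1%:R * h%:R)) ^+ N) G1 _ (bG _ bA) (bG _ bB) _) _.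
- by apply: mulr_ge0 => //; apply: exprn_ge0; nra.
- by move=> i j; rewrite !mxE opprB addrA subrK; exact: close_expr.
- by rewrite /det_modulus !(natrM, natrX, natrD) /G le_eqVlt; apply/orP; left; apply/eqP; ring.
Qed.

End Perturbation.

(** * The capacity decreases with the support *)

Section Support.
Variables (R : realType) (X Y : finType).
Implicit Types W V : X -> Y -> R.

Definition channel_ge0 W := forall x y, 0 <= W x y.
Definition support_le V W := forall x y, 0 < V x y -> 0 < W x y.

Lemma channel_pow_ge0 W m (x : m.-tuple X) y : channel_ge0 W -> 0 <= channel_pow W x y.
Proof. by move=> h; apply: prodr_ge0. Qed.

Lemma orthogonal_words_le V W m (x x' : m.-tuple X) :
  channel_ge0 V -> channel_ge0 W -> support_le V W ->
  orthogonal_words W x x' -> orthogonal_words V x x'.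
Proof.
move=> hV hW VW; rewrite /orthogonal_words !psumr_eq0; last 2 first.
- by move=> y _; rewrite mulr_ge0 ?channel_pow_ge0.
- by move=> y _; rewrite mulr_ge0 ?channel_pow_ge0.
have zero u y : channel_pow W u y == 0 -> channel_pow V u y == 0.
  rewrite /channel_pow => /prodf_eq0[j _ /eqP h]; apply/prodf_eq0; exists j => //.
  apply/negPn/negP => h'; have := VW (tnth u j) (tnth y j).
  by rewrite lt0r h' hV h ltxx => /(_ isT).
move=> /allP h; apply/allP => y /h; rewrite !mulf_eq0 => /orP[] /zero ->; rewrite ?orbT //.
Qed.

Lemma max_code_le V W m : channel_ge0 V -> channel_ge0 W -> support_le V W ->
  (max_code W m <= max_code V m)%N.
Proof.
move=> hV hW VW; rewrite /max_code; apply/bigmax_leqP => S /'forall_implyP hS.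
apply: (@leq_bigmax_cond _ _ (fun S : {set m.-tuple X} => #|S|)).
apply/'forall_implyP => x xS; apply/'forall_implyP => x' x'S; apply/implyP => ne.
have /'forall_implyP /(_ x' x'S) /implyP /(_ ne) := hS x xS.
exact: orthogonal_words_le.
Qed.

Lemma log2_nat_le a b : (a <= b)%N -> log2 a%:R <= log2 b%:R :> R.
Proof.
have l2 : 0 < (ln 2)^-1 :> R by rewrite invr_gt0 ln_gt0 // ltr1n.
move=> ab; rewrite /log2 ler_pM2r //; case: a ab => [|a] ab.
  rewrite ln0 //; case: b {ab} => [|b]; first by rewrite ln0.
  by rewrite ln_ge0 // ler1n.
by rewrite ler_ln ?posrE ?ltr0n ?ler_nat // (leq_trans _ ab).
Qed.

Lemma limn_einf_le (u v : nat -> \bar R) :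
  (forall n, u n <= v n)%E -> (limn_einf u <= limn_einf v)%E.
Proof.
move=> uv; rewrite !limn_einf_lim; apply: lee_lim; [exact: is_cvg_einfs..|].
apply: nearW => n; apply: le_ereal_inf_tmp => _ [k /= nk <-].
by apply: le_trans (uv k); apply: ereal_inf_lbound; exists k.
Qed.

Lemma C0_le V W : channel_ge0 V -> channel_ge0 W -> support_le V W -> (C0 W <= C0 V)%E.
Proof.
move=> hV hW VW; apply: limn_einf_le => m; rewrite lee_fin.
by apply: ler_wpM2l; rewrite ?invr_ge0 ?ler0n // log2_nat_le // max_code_le.
Qed.

Lemma C0_ge0 W : (0 <= C0 W)%E.
Proof.
have <- : limn_einf (fun=> 0%E : \bar R) = 0%E.
  by have [-> _] := cvg_limn_einf_sup (cvg_cst (0%E : \bar R)).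
apply: limn_einf_le => m; rewrite lee_fin mulr_ge0 ?invr_ge0 ?ler0n //.
by apply: le_trans (log2_nat_le (leq0n _)); rewrite /log2 ln0 // mul0r.
Qed.

Lemma log2_inv_le s t : 0 <= s -> s <= t -> (log2_inv t <= log2_inv s :> \bar R)%E.
Proof.
move=> s0 st; rewrite /log2_inv.
have [_|sn] := eqVneq s 0; first by rewrite leey.
have sp : 0 < s by rewrite lt0r sn.
have tp : 0 < t by apply: lt_le_trans st.
rewrite gt_eqF // lee_fin /log2 ler_pM2r ?invr_gt0 ?ln_gt0 ?ltr1n //.
by rewrite ler_ln ?posrE ?divr_gt0 // !div1r lef_pV2.
Qed.

Lemma log2_inv_ge0 s : 0 <= s <= 1 -> (0 <= log2_inv s :> \bar R)%E.
Proof.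
move=> /andP[s0 s1]; apply: le_trans (log2_inv_le s0 s1).
by rewrite /log2_inv oner_eq0 lee_fin /log2 divr1 ln1 mul0r.
Qed.

Definition min_information W (P : X -> R) : \bar R :=
  \big[Order.min/+oo%E]_(y : Y) log2_inv (\sum_(x | 0 < W x y) P x).

Lemma min_information_le V W P : (forall x, 0 <= P x) -> support_le V W ->
  (min_information W P <= min_information V P)%E.
Proof.
move=> P0 VW; apply: le_bigmin2 => y _; apply: log2_inv_le; first exact: sumr_ge0.
rewrite [leLHS]big_mkcond [leRHS]big_mkcond; apply: ler_sum => x _.
by case: ifP => [/VW ->//|_]; case: ifP.
Qed.

(** More possible outputs mean fewer orthogonal words and less information per
    output. The value 0 of a channel without zero-error capacity fits in because
    all the other values are nonnegative. *)
Lemma C0FB_le V W : channel_ge0 V -> channel_ge0 W -> support_le V W ->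
  (C0FB W <= C0FB V)%E.
Proof.
move=> hV hW VW; rewrite /C0FB.
have [CV|CV] := eqVneq (C0 V) 0%E.
  have -> : C0 W == 0%E by rewrite eq_le C0_ge0 andbT -CV C0_le.
  exact: lexx.
have [CW|CW] := eqVneq (C0 W) 0%E; last first.
  apply: ge_ereal_sup => _ [P /= [P0 P1] <-].
  apply: le_trans (min_information_le P0 VW) _; apply: ereal_sup_ubound.
  by exists P.
have [[x0]|noX] := pselect (inhabited X); last first.
  suff VW' : V = W by rewrite VW' CW eqxx in CV.
  by apply/funext => x; case: noX.
pose P := fun x => (x == x0)%:R : R.
have P0 x : 0 <= P x by rewrite ler0n.
have P1 : \sum_x P x = 1.
  by rewrite (bigD1 x0) //= big1 ?addr0 /P ?eqxx // => x /negbTE ->.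
apply: (@le_trans _ _ (min_information V P)); last by apply: ereal_sup_ubound; exists P.
apply: le_bigmin; first exact: leey.
move=> y _; apply: log2_inv_ge0; rewrite sumr_ge0 //= -P1 [leLHS]big_mkcond ler_sum // => x _.
by case: ifP.
Qed.

Definition indicator (S : {set X * Y}) : X -> Y -> R := fun x y => ((x, y) \in S)%:R.

Lemma indicator_gt0 S x y : (0 < indicator S x y) = ((x, y) \in S).
Proof. by rewrite /indicator ltr0n lt0b. Qed.

(** There are finitely many supports, and the positivity of the entries on a
    given one is semi-decidable, whereas their vanishing is not: by monotonicity
    a part of the support suffices. *)
Lemma C0FB_lt_support W (a : \bar R) : channel_ge0 W ->
  (C0FB W < a)%E <->
  exists S : {set X * Y}, (forall x y, (x, y) \in S -> 0 < W x y) /\ (C0FB (indicator S) < a)%E.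
Proof.
have ind0 (S : {set X * Y}) : channel_ge0 (indicator S) by move=> x y; exact: ler0n.
move=> hW; split=> [h|[S [SW h]]].
  exists [set p | 0 < W p.1 p.2]; split; first by move=> x y; rewrite inE.
  by apply: le_lt_trans h; apply: C0FB_le => // x y; rewrite indicator_gt0 inE.
apply: le_lt_trans h; apply: C0FB_le => // x y; rewrite indicator_gt0; exact: SW.
Qed.

End Support.

(** * Linear programs with rational data have rational values *)

Section Elimination.
Variable R : realFieldType.

Definition cons_env (t : R) (x : nat -> R) : nat -> R :=
  fun i => if i is j.+1 then x j else t.

Definition form_val k (a : nat -> rat) (x : nat -> R) : R := \sum_(i < k) ratr (a i) * x i.

Definition form_tail (a : nat -> rat) : nat -> rat := fun i => a i.+1.

Lemma form_val_cons k a t x :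
  form_val k.+1 a (cons_env t x) = ratr (a 0%N) * t + form_val k (form_tail a) x.
Proof. by rewrite /form_val big_ord_recl. Qed.

Lemma form_val_lin k (c d : rat) a b x :
  form_val k (fun i => c * a i + d * b i) x
  = ratr c * form_val k a x + ratr d * form_val k b x.
Proof.
rewrite /form_val !mulr_sumr -big_split /=; apply: eq_bigr => i _.
by rewrite rmorphD !rmorphM /=; ring.
Qed.

(** Fourier-Motzkin: a lower bound [p] and an upper bound [q] on the first
    variable leave the condition that they do not cross; other pairs leave
    the forms without this variable. *)
Definition eliminate (I : finType) (L : I -> nat -> rat) (pq : I * I) : nat -> rat :=
  let: (p, q) := pq in
  if (0 < L p 0%N) && (L q 0%N < 0) then
    fun i => L p 0%N * form_tail (L q) i + (- L q 0%N) * form_tail (L p) i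
  else if L p 0%N == 0 then form_tail (L p) else fun=> 0.

Lemma form_val0 k x : form_val k (fun=> 0) x = 0.
Proof. by apply: big1 => i _; rewrite rmorph0 mul0r. Qed.

Lemma eliminateP (I : finType) (L : I -> nat -> rat) k x :
  (exists t, forall i, 0 <= form_val k.+1 (L i) (cons_env t x)) <->
  forall pq, 0 <= form_val k (eliminate L pq) x.
Proof.
pose c i : R := ratr (L i 0%N); pose v i := form_val k (form_tail (L i)) x.
have cp i : (0 < L i 0%N) = (0 < c i) by rewrite /c ltr0q.
have cn i : (L i 0%N < 0) = (c i < 0) by rewrite /c ltrq0.
have cz i : (L i 0%N == 0) = (c i == 0) by rewrite /c fmorph_eq0.
have val t i : form_val k.+1 (L i) (cons_env t x) = c i * t + v i.
  exact: form_val_cons.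
have elimE p q : form_val k (eliminate L (p, q)) x =
    if (0 < c p) && (c q < 0) then c p * v q - c q * v p
    else if c p == 0 then v p else 0.
  rewrite /eliminate cp cn cz; case: ifP => _; last by case: ifP => _ //; rewrite form_val0.
  by rewrite form_val_lin rmorphN mulNr.
split=> [[t ht] [p q]|h].
  rewrite elimE; case: ifP => [/andP[h1 h2]|_].
    by have := ht p; have := ht q; rewrite !val; nra.
  case: eqP => // e; by have := ht p; rewrite val e mul0r add0r.
pose low i := - v i / c i.
have [/existsP[p0 hp0]|/existsPn nopos] := boolP [exists p, 0 < c p].
  have [p hp hmax] := arg_maxP (P := fun p => 0 < c p) low hp0.
  exists (low p) => i; rewrite val.
  have cpp : c p * low p = - v p by rewrite mulrC divfK // gt_eqF.
  have [ci|ci|ci] := ltgtP (c i) 0.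
  - have := h (p, i); rewrite elimE hp ci /= => H.
    have : 0 <= c p * (c i * low p + v i) by rewrite mulrDr mulrCA cpp; lra.
    by rewrite pmulr_rge0.
  - have := hmax i ci; rewrite /= => H.
    have : c i * low i <= c i * low p by rewrite ler_pM2l.
    rewrite [c i * low i]mulrC divfK ?gt_eqF //; lra.
  - have := h (i, i); rewrite elimE ci ltxx eqxx /=; lra.
have [/existsP[q0 hq0]|/existsPn noneg] := boolP [exists q, c q < 0].
  have [q hq hmin] := arg_minP (P := fun q => c q < 0) low hq0.
  exists (low q) => i; rewrite val.
  have [ci|ci|ci] := ltgtP (c i) 0.
  - have := hmin i ci; rewrite /= => H.
    have : c i * low i <= c i * low q by rewrite ler_nM2l.
    rewrite [c i * low i]mulrC divfK ?lt_eqF //; lra.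
  - by have := nopos i; rewrite ci.
  - have := h (i, i); rewrite elimE ci ltxx eqxx /=; lra.
exists 0 => i; rewrite val mulr0 add0r.
have ci : c i = 0 by have := nopos i; have := noneg i; rewrite -!leNgt => ? ?; lra.
by have := h (i, i); rewrite elimE ci ltxx eqxx.
Qed.

Definition extend_env (xs : seq R) (y : nat -> R) := foldr cons_env y xs.

Lemma eliminate_many m k (I : finType) (L : I -> nat -> rat) :
  exists (J : finType) (M : J -> nat -> rat), forall y,
    (exists2 xs, size xs = m & forall i, 0 <= form_val (m + k) (L i) (extend_env xs y)) <->
    forall j, 0 <= form_val k (M j) y.
Proof.
elim: m I L => [|m IH] I L.
  exists I, L => y; split=> [[xs /size0nil -> h] i|h]; last by exists [::].
  exact: h.
have [J [M hM]] := IH _ (eliminate L); exists J, M => y; rewrite -hM; split.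
  case=> -[|t xs] //= [sz h]; exists xs => //; apply/eliminateP.
  by exists t.
case=> xs sz /eliminateP[t ht]; exists (t :: xs) => //=; by rewrite sz.
Qed.

(** In one variable, the feasible set of a bounded program is cut out by
    finitely many rational thresholds, the largest of which is the optimum. *)
Lemma program_min_rat m (I : finType) (L : I -> nat -> rat) :
  let feasible t := exists2 xs, size xs = m & forall i,
    0 <= form_val (m + 2) (L i) (extend_env xs (cons_env t (fun=> 1))) in
  (exists t, feasible t) -> (forall t, feasible t -> 0 <= t) ->
  exists v : rat, feasible (ratr v) /\ forall t, feasible t -> ratr v <= t.
Proof.
move=> feasible [t0 ft0] pos.
have [J [M hM]] := eliminate_many m 2 L.
have hf t : feasible t <-> forall j, 0 <= ratr (M j 0%N) * t + ratr (M j 1%N).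
  rewrite /feasible hM; split=> h j; have := h j;
  by rewrite /form_val !big_ord_recl big_ord0 /= addr0 mulr1.
have [/existsP[p0 hp0]|/existsPn nopos] := boolP [exists p, 0 < M p 0%N]; last first.
  have : feasible (- 1 - `|t0|).
    apply/hf => j; have := (hf t0).1 ft0 j.
    have : ratr (M j 0%N) <= 0 :> R by rewrite lerq0 leNgt nopos.
    have := ler_norm (- t0); rewrite normrN; nra.
  by move=> /pos; have := normr_ge0 t0; lra.
have [p hp hmax] := arg_maxP (P := fun p => 0 < M p 0%N) (fun i => - M i 1%N / M i 0%N) hp0.
exists (- M p 1%N / M p 0%N).
have low t : feasible t -> ratr (- M p 1%N / M p 0%N) <= t.
  move=> /hf /(_ p) h; rewrite rmorphM rmorphN fmorphV /= ler_pdivrMr ?ltr0q //; lra.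
split=> //; apply/hf => j; have [hj|hj] := ltP 0 (M j 0%N); last first.
  have := (hf t0).1 ft0 j; have := low t0 ft0.
  have : ratr (M j 0%N) <= 0 :> R by rewrite lerq0.
  nra.
have := hmax j hj; rewrite /= ler_pdivrMr // -(ler_rat R) rmorphM rmorphN /=; lra.
Qed.

End Elimination.

(** * The values of the capacity *)

Section GameValue.
Variables (R : realType) (X Y : finType) (S : {set X * Y}).
Local Notation W := (indicator R S).

Lemma extend_envE (xs : seq R) y i :
  extend_env xs y i = if (i < size xs)%N then xs`_i else y (i - size xs)%N.
Proof.
by elim: xs i => [|x xs IH] [|i] //=; rewrite ?subn0 // IH ltnS subSS.
Qed.

Variable x0 : X.

(** The variables are the probabilities of the letters, in the order of
    [enum X], followed by the bound [t] and by the constant 1. *)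
Definition program_form (a : X -> rat) (b c : rat) : nat -> rat :=
  fun i => if (i < #|X|)%N then a (nth x0 (enum X) i)
           else if i == #|X| then b else c.

Lemma program_formE a b c (xs : seq R) (t : R) : size xs = #|X| ->
  form_val (#|X| + 2) (program_form a b c) (extend_env xs (cons_env t (fun=> 1)))
  = \sum_x ratr (a x) * xs`_(index x (enum X)) + ratr b * t + ratr c.
Proof.
move=> sz; rewrite /form_val addn2 !big_ord_recr /=; congr (_ + _ + _).
- rewrite -[RHS]big_enum /= (big_nth x0) -cardE.
  rewrite big_mkord; apply: eq_bigr => i _.
  by rewrite /program_form extend_envE sz ltn_ord index_uniq ?enum_uniq // -cardE.
- by rewrite /program_form extend_envE sz ltnn eqxx subnn.
- rewrite /program_form extend_envE sz ltnNge leqnSn /= gtn_eqF // subSnn /=.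
  by rewrite mulr1.
Qed.

(** The distribution [P] bounds the probability of being compatible with any
    output by [t]; the capacity is the logarithm of the inverse of the least
    such [t]. *)
Definition guarantees (t : R) : Prop :=
  exists P, [/\ is_distribution P, 0 <= t & forall y, \sum_(x | 0 < W x y) P x <= t].

Lemma game_value_rat : exists v : rat,
  guarantees (ratr v) /\ forall t, guarantees t -> ratr v <= t.
Proof.
pose I : finType := (X + (bool + (Y + unit)))%type.
pose L (i : I) : nat -> rat := match i with
  | inl x => program_form (fun x' => (x' == x)%:R) 0 0
  | inr (inl true) => program_form (fun=> 1) 0 (- 1)
  | inr (inl false) => program_form (fun=> - 1) 0 1
  | inr (inr (inl y)) => program_form (fun x => - (0 < W x y)%R%:R) 1 0
  | inr (inr (inr tt)) => program_form (fun=> 0) 1 0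
  end.
have E t : guarantees t <-> exists2 xs, size xs = #|X| & forall i,
    0 <= form_val (#|X| + 2) (L i) (extend_env xs (cons_env t (fun=> 1))).
  have sumP (P : X -> R) y : \sum_x ratr (- (0 < W x y)%R%:R) * P x
      = - \sum_(x | 0 < W x y) P x.
    rewrite [in RHS]big_mkcond /= -sumrN; apply: eq_bigr => x _; case: ifP => _.
      by rewrite rmorphN rmorph1 mulN1r.
    by rewrite oppr0 rmorph0 mul0r oppr0.
  have sum1 (P : X -> R) c : \sum_x ratr c * P x = ratr c * \sum_x P x by rewrite mulr_sumr.
  split=> [[P [[P0 P1] t0 Pt]]|[xs sz h]].
    have szP : size [seq P x | x <- enum X] = #|X| by rewrite size_map -cardE.
    exists [seq P x | x <- enum X] => //.
    have nthP x : [seq P x | x <- enum X]`_(index x (enum X)) = P x.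
      by rewrite (nth_map x0) ?nth_index ?mem_enum // index_mem mem_enum.
    have sumN a : \sum_x ratr (a x) * [seq P x | x <- enum X]`_(index x (enum X))
        = \sum_x ratr (a x) * P x :> R by apply: eq_bigr => x _; rewrite nthP.
    case=> [x|[[]|[y|[]]]]; rewrite /L (program_formE _ _ _ _ szP) sumN ?sumP ?sum1 ?P1;
      rewrite ?rmorphN ?rmorph1 ?rmorph0.
    - rewrite (bigD1 x) //= eqxx rmorph1 mul1r big1 ?addr0 ?mul0r ?addr0 //.
      by move=> x' /negbTE ->; rewrite rmorph0 mul0r.
    - lra.
    - lra.
    - have := Pt y; lra.
    - lra.
  pose P x := xs`_(index x (enum X)).
  exists P; split; first split=> [x|].
  - have := h (inl x); rewrite /= program_formE // rmorph0 mul0r !addr0.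
    rewrite (bigD1 x) //= eqxx rmorph1 mul1r big1 ?addr0 //.
    by move=> x' /negbTE ->; rewrite rmorph0 mul0r.
  - have := h (inr (inl true)); have := h (inr (inl false)).
    rewrite /= !program_formE // !sum1 ?rmorphN ?rmorph1 ?rmorph0 -/P; lra.
  - have := h (inr (inr (inr tt))).
    by rewrite /= program_formE // sum1 rmorph0 rmorph1; lra.
  - move=> y; have := h (inr (inr (inl y))).
    by rewrite /= program_formE // sumP rmorph0 rmorph1; lra.
have [||v [fv minv]] := @program_min_rat R #|X| I L.
- exists 1; apply/E; exists (fun x => (x == x0)%:R).
  have P0 x : 0 <= (x == x0)%:R :> R by rewrite ler0n.
  have P1 : \sum_x (x == x0)%:R = 1 :> R.
    by rewrite (bigD1 x0) //= big1 ?addr0 ?eqxx // => x /negbTE ->.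
  split; [by split | exact: ler01 | move=> y];
    rewrite -[leRHS]P1 [leLHS]big_mkcond ler_sum // => x _.
  by case: (0 < W x y) => //; exact: P0.
- by move=> t /E[P [_ t0 _]].
by exists v; split; [apply/E | move=> t /E /minv].
Qed.

Lemma C0FB_value (v : rat) : guarantees (ratr v) -> (forall t, guarantees t -> ratr v <= t) ->
  C0 W != 0%E -> C0FB W = log2_inv (ratr v : R).
Proof.
move=> [P [dP v0 hP]] minv CW; rewrite /C0FB (negbTE CW); apply/eqP; rewrite eq_le.
apply/andP; split.
  apply: ge_ereal_sup => _ [Q /= dQ <-].
  have [Q0 Q1] := dQ.
  have [->|vn] := eqVneq (ratr v : R) 0; first by rewrite /log2_inv eqxx leey.
  have vp : 0 < (ratr v : R) by rewrite lt0r vn.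
  have [y hy] : exists y, ratr v <= \sum_(x | 0 < W x y) Q x.
    apply: contrapT => nex.
    have lt y : \sum_(x | 0 < W x y) Q x < ratr v.
      by rewrite ltNge; apply/negP => h; apply: nex; exists y.
    pose t := \big[Order.max/0]_y \sum_(x | 0 < W x y) Q x.
    have : guarantees t.
      exists Q; split=> //; first exact: bigmax_ge_id.
      by move=> y; exact: le_bigmax.
    move=> /minv; rewrite leNgt => /negP; apply.
    by apply: bigmax_lt.
  by apply/bigmin_leP; right; exists y => //; apply: log2_inv_le.
apply: (@le_trans _ _ (min_information W P)); last by apply: ereal_sup_ubound; exists P.
apply: le_bigmin; first exact: leey.
by move=> y _; apply: log2_inv_le => //; apply: sumr_ge0 => x _; case: dP.
Qed.

End GameValue.

(** The capacity of a support is the logarithm of a rational or infinite, so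
    that comparing it with the logarithm of [M] is comparing a constant
    fraction with [M]. *)
Lemma C0FB_indicator_lt (R : realType) (X Y : finType) (S : {set X * Y}) :
  (forall M : R, 1 <= M -> ~ (C0FB (indicator R S) < (log2 M)%:E)%E) \/
  exists p q : nat, [/\ (0 < p)%N, (0 < q)%N &
    forall M : R, 1 <= M -> (C0FB (indicator R S) < (log2 M)%:E)%E <-> p%:R / q%:R < M].
Proof.
have log2_lt (a M : R) : 0 < a -> 1 <= M -> ((log2 a)%:E < (log2 M)%:E)%E = (a < M).
  move=> a0 M1; rewrite lte_fin /log2 ltr_pM2r ?invr_gt0 ?ln_gt0 ?ltr1n //.
  by rewrite ltr_ln ?posrE //; lra.
have [C|C] := eqVneq (C0 (indicator R S)) 0%E.
  right; exists 1%N, 1%N; split=> // M M1; rewrite /C0FB C eqxx.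
  have -> : 0%E = (log2 1)%:E :> \bar R by rewrite /log2 ln1 mul0r.
  by rewrite log2_lt // divr1.
have [[x0]|noX] := pselect (inhabited X); last first.
  suff : C0 (indicator R S) = 0%E by move=> e; rewrite e eqxx in C.
  rewrite /C0 (_ : (fun m => _) = fun=> 0%E).
    by have [-> _] := cvg_limn_einf_sup (cvg_cst (0%E : \bar R)).
  apply/funext => -[|m]; first by rewrite invr0 mul0r.
  suff -> : max_code (indicator R S) m.+1 = 0%N by rewrite /log2 ln0 // mul0r mulr0.
  apply/eqP; rewrite -leqn0; apply/bigmax_leqP => A _; rewrite leqn0 cards_eq0.
  by apply/eqP/setP => u; case: noX; exists; exact: (tnth u ord0).
have [v [gv minv]] := game_value_rat R S x0.
rewrite (C0FB_value gv minv C); have [_ [_ v0 _]] := gv.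
rewrite /log2_inv; have [e|vn] := eqVneq (ratr v : R) 0; first by left.
have vp : 0 < v by rewrite -(ltr0q R) lt0r vn.
right; exists `|denq v|%N, `|numq v|%N; split.
- by rewrite absz_gt0 denq_neq0.
- by rewrite absz_gt0 numq_eq0 gt_eqF.
have v1 : 0 < 1 / ratr v :> R by rewrite div1r invr_gt0 ltr0q.
move=> M M1; rewrite log2_lt //.
suff -> : 1 / ratr v = `|denq v|%:R / `|numq v|%:R :> R by [].
have nat_int (z : int) : 0 <= z -> `|z|%N%:R = z%:~R :> R.
  by move=> z0; rewrite -[in RHS](gez0_abs z0).
by rewrite div1r /ratr invf_div !nat_int ?denq_ge0 ?numq_ge0 // ltW.
Qed.

(** * Computing determinants of powers of integer matrices *)

Section Vectors.
Variable T : finType.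
Local Open Scope nat_scope.

Definition vcode (v : T -> nat) : nat := lcode [seq v x | x <- enum T].
Definition vdecode (c : nat) (x : T) : nat := lnth c (index x (enum T)).

Lemma vcodeK v : vdecode (vcode v) = v.
Proof.
apply/funext => x; rewrite /vdecode lnthK (nth_map x) ?index_mem ?mem_enum //.
by rewrite nth_index ?mem_enum.
Qed.

Lemma computable_vcode (v : T -> env -> nat) : (forall x, computable (v x)) ->
  computable (fun e => vcode (fun x => v x e)).
Proof.
move=> hv; rewrite /vcode; elim: (enum T) => [|x l IH] /=; first exact: computable_0.
exact: computable_succ (computable_npair (hv x) IH).
Qed.

Lemma computable_iter_vector (F : (T -> nat) -> env -> T -> nat) (v0 : env -> T -> nat) n :
  (forall x, computable (fun e => v0 e x)) -> computable n ->
  (forall x, computable (fun e => F (vdecode (e 0)) (etail e) x)) ->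
  forall x, computable (fun e => iter (n e) (fun v => F v e) (v0 e) x).
Proof.
move=> h0 hn hF x.
have hrec : computable (fun e => nat_rect (fun=> nat) (vcode (v0 e))
    (fun k y => vcode (F (vdecode y) e)) (n e)).
  apply: (computable_rec (h := fun k y e => vcode (F (vdecode y) e))) hn _.
    exact: computable_vcode.
  apply: computable_vcode => y; exact: (computable_ren (fun i => i.+1) (hF y)).
apply: eq_computable (computable_lnth hrec (computable_const (index x (enum T)))) => e.
rewrite -[LHS]/(vdecode _ x); congr (_ x).
by elim: (n e) => [|k IH] /=; rewrite vcodeK ?IH.
Qed.

Lemma computable_sum_fin (f : T -> env -> nat) : (forall x, computable (f x)) ->
  computable (fun e => \sum_x f x e).
Proof.
move=> hf; have H l : computable (fun e => \sum_(x <- l) f x e).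
  elim: l => [|x l IH].
    by apply: eq_computable computable_0 => e; rewrite big_nil.
  by apply: eq_computable (computable_add (hf x) IH) => e; rewrite big_cons.
exact: H.
Qed.

Lemma computable_prod_fin (P : pred T) (f : T -> env -> nat) : (forall x, computable (f x)) ->
  computable (fun e => \prod_(x | P x) f x e).
Proof.
move=> hf; have H l : computable (fun e => \prod_(x <- l | P x) f x e).
  elim: l => [|x l IH].
    by apply: eq_computable (computable_const 1) => e; rewrite big_nil.
  case Px: (P x); last by apply: eq_computable IH => e; rewrite big_cons Px.
  by apply: eq_computable (computable_mul (hf x) IH) => e; rewrite big_cons Px.
exact: H.
Qed.

End Vectors.

(** Integers are handled as differences of natural numbers. *)
Definition computableZ (g : env -> int) : Prop :=
  exists p m, [/\ computable p, computable m & forall e, g e = (p e)%:Z - (m e)%:Z].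

Lemma eq_computableZ f g : f =1 g -> computableZ f -> computableZ g.
Proof. by move=> fg [p [m [hp hm h]]]; exists p, m; split=> // e; rewrite -fg. Qed.

Lemma computableZ_nat p : computable p -> computableZ (fun e => (p e)%:Z).
Proof. by move=> hp; exists p, (fun=> 0%N); split=> // [|e];
  [exact: computable_0 | rewrite subr0]. Qed.

Lemma computableZ_opp f : computableZ f -> computableZ (fun e => - f e).
Proof. by move=> [p [m [hp hm h]]]; exists m, p; split=> // e; rewrite h opprB. Qed.

Lemma computableZ_add f g : computableZ f -> computableZ g -> computableZ (fun e => f e + g e).
Proof.
move=> [p [m [hp hm h]]] [p' [m' [hp' hm' h']]].
exists (fun e => p e + p' e)%N, (fun e => m e + m' e)%N; split; [exact: computable_add..|].
by move=> e; rewrite h h' !PoszD; ring.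
Qed.

Lemma computableZ_mul f g : computableZ f -> computableZ g -> computableZ (fun e => f e * g e).
Proof.
move=> [p [m [hp hm h]]] [p' [m' [hp' hm' h']]].
exists (fun e => p e * p' e + m e * m' e)%N, (fun e => p e * m' e + m e * p' e)%N.
split; [by apply: computable_add; apply: computable_mul..|].
by move=> e; rewrite h h' !PoszD !PoszM; ring.
Qed.

Lemma computableZ_sum (T : finType) (f : T -> env -> int) : (forall x, computableZ (f x)) ->
  computableZ (fun e => \sum_x f x e).
Proof.
move=> hf; have H l : computableZ (fun e => \sum_(x <- l) f x e).
  elim: l => [|x l IH].
    by apply: eq_computableZ (computableZ_nat computable_0) => e; rewrite big_nil.
  by apply: eq_computableZ (computableZ_add (hf x) IH) => e; rewrite big_cons.
exact: H.
Qed.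

Lemma computableZ_prod (T : finType) (f : T -> env -> int) : (forall x, computableZ (f x)) ->
  computableZ (fun e => \prod_x f x e).
Proof.
move=> hf; have H l : computableZ (fun e => \prod_(x <- l) f x e).
  elim: l => [|x l IH].
    by apply: eq_computableZ (computableZ_nat (computable_const 1)) => e; rewrite big_nil.
  by apply: eq_computableZ (computableZ_mul (hf x) IH) => e; rewrite big_cons.
exact: H.
Qed.

Lemma computableZ_sign s : computable s -> computableZ (fun e => (-1) ^+ s e).
Proof.
move=> hs; exists (fun e => (~~ odd (s e)) : nat), (fun e => odd (s e) : nat).
split; [exact: computable_negb (computable_odd hs) | exact: computable_odd |] => e.
by rewrite -signr_odd; case: (odd (s e)).
Qed.

Lemma computable_absz f : computableZ f -> computable (fun e => `|f e|%N).
Proof.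
move=> [p [m [hp hm h]]].
apply: eq_computable (computable_add (computable_sub hp hm) (computable_sub hm hp)) => e.
rewrite h; lia.
Qed.

Section Matrices.
Variable d : nat.
Implicit Types (G : env -> 'M[int]_d.+1).

Definition computable_mx G : Prop := forall i j, computableZ (fun e => G e i j).

Lemma computableZ_det G : computable_mx G -> computableZ (fun e => \det (G e)).
Proof.
move=> hG; apply: computableZ_sum => s; apply: computableZ_mul.
  exact: computableZ_sign (computable_const _).
by apply: computableZ_prod => i; exact: hG.
Qed.

(** The recursion runs on the positive and negative parts of all entries. *)
Lemma computable_mx_expr G N : computable_mx G -> computable N ->
  computable_mx (fun e => G e ^+ N e).
Proof.
move=> hG hN.
have /choice [pm hpm] : forall ij : 'I_d.+1 * 'I_d.+1, exists pm : (env -> nat) * (env -> nat),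
    [/\ computable pm.1, computable pm.2 & forall e, G e ij.1 ij.2 = (pm.1 e)%:Z - (pm.2 e)%:Z].
  by move=> [i j]; have [p [m h]] := hG i j; exists (p, m).
pose p ij := (pm ij).1; pose m ij := (pm ij).2.
pose F (v : ('I_d.+1 * 'I_d.+1) * bool -> nat) (e : env) (x : ('I_d.+1 * 'I_d.+1) * bool) :=
  let: ((i, j), b) := x in
  (\sum_(k < d.+1) (p (i, k) e * v ((k, j), b) + m (i, k) e * v ((k, j), ~~ b)))%N.
pose v0 (x : ('I_d.+1 * 'I_d.+1) * bool) : nat :=
  let: ((i, j), b) := x in (b && (i == j)).
have hv : forall x, computable (fun e => iter (N e) (fun v => F v e) v0 x).
  apply: (computable_iter_vector (v0 := fun=> v0)) hN _ => [x|[[i j] b]];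
    first exact: computable_const.
  apply: computable_sum_fin => k; have [h1 h2 _] := hpm (i, k).
  by apply: computable_add; apply: computable_mul; do ?[exact: computable_shift];
    apply: computable_lnth (computable_var 0) (computable_const _).
move=> i j; exists (fun e => iter (N e) (fun v => F v e) v0 ((i, j), true)),
  (fun e => iter (N e) (fun v => F v e) v0 ((i, j), false)); split=> // e.
elim: (N e) i j => [|n IH] i j; first by rewrite expr0 mxE /=; case: eqP.
rewrite exprS mxE /= !(big_morph Posz PoszD (erefl _)) -sumrB; apply: eq_bigr => k _.
have [_ _ /(_ e) /= ->] := hpm (i, k); rewrite IH !PoszD !PoszM /p /m; ring.
Qed.

End Matrices.

(** * Approximations of described reals *)

(** [(-1)^s a / b] is the [k]-th rational of the sequence described by [t]. *)
Definition approx (t : seq_prog) (k a b s : nat) : Prop :=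
  [/\ eval (num_prog t) [:: k] a, eval (den_prog t) [:: k] b
    & eval (sgn_prog t) [:: k] s].

Definition fraction (R : realFieldType) (a b s : nat) : R := (-1) ^+ s * a%:R / b%:R.

Lemma approxP (R : realType) t (x : R) : describes_real t x ->
  (forall k, exists a b s, approx t k a b s) /\
  (forall k a b s, approx t k a b s -> (0 < b)%N /\ `|x - fraction R a b s| < 2 ^- k).
Proof.
move=> [r [a [b [s [ha hb hs b0 hr]]]] hx]; split.
  by move=> k; exists (a k), (b k), (s k); split.
move=> k a' b' s' [h1 h2 h3].
rewrite (eval_functional h1 (ha k)) (eval_functional h2 (hb k)) (eval_functional h3 (hs k)).
split; first by rewrite lt0n; apply/eqP.
have := hx k; rewrite hr /fraction.
by rewrite !rmorphM /= fmorphV rmorphXn /= rmorphN1 !ratr_nat.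
Qed.

Lemma half_pow_small (R : realType) (x : R) : 0 < x -> exists k, 2 ^- k < x.
Proof.
move=> x0; have [N hN] := @bernoulli_unbounded R 2 x^-1 (ltr1n _ 2).
by exists N.+1; rewrite invf_plt ?posrE ?exprn_gt0.
Qed.

(** A positive [x] exceeds [2 * 2^-k] for some [k], and its [k]-th approximation
    then exceeds [2^-k], which conversely proves [x] positive. *)
Lemma pos_approx (R : realType) t (x : R) : describes_real t x ->
  0 < x <-> exists k a b s, approx t k a b s /\ (~~ odd s && (b <= a * 2 ^ k)%N).
Proof.
move=> /approxP[ex ap]; split=> [x0|[k [a [b [s [h /andP[so ab]]]]]]]; last first.
  have [b0 hx] := ap _ _ _ _ h.
  have : 2 ^- k <= fraction R a b s.
    rewrite /fraction -signr_odd (negbTE so) mul1r ler_pdivlMr ?ltr0n //.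
    by rewrite ler_pdivrMl ?exprn_gt0 // mulrC -natrX -natrM ler_nat.
  have := ler_norm (fraction R a b s - x); rewrite distrC => h1 h2; lra.
have [k hk] := @half_pow_small R (x / 2) ltac:(lra).
have [a [b [s h]]] := ex k; exists k, a, b, s; split=> //.
have [b0 hx] := ap _ _ _ _ h.
have f1 : 2 ^- k < fraction R a b s.
  have := ler_norm (x - fraction R a b s); lra.
have k0 : 0 < 2 ^- k :> R by rewrite invr_gt0 exprn_gt0.
have ab0 : 0 <= a%:R / b%:R :> R by rewrite divr_ge0.
move: f1; rewrite /fraction -signr_odd; case: (odd s) => f1.
  by move: f1; rewrite expr1 mulN1r mulNr; lra.
move: f1; rewrite mul1r ltr_pdivlMr ?ltr0n // ltr_pdivrMl ?exprn_gt0 // mulrC => f1.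
by rewrite /= -(ler_nat R) natrM natrX ltW.
Qed.

(** * Growth of the plant from rational approximations *)

Section Plant.
Variables (R : realType) (d : nat).
Local Notation I := ('I_d.+1 * 'I_d.+1)%type.
Implicit Types (a b s : I -> nat).

Definition common_den b : nat := (\prod_ij b ij)%N.
Definition scaled_entry a b s (ij : I) : int :=
  (-1) ^+ s ij * (a ij)%:Z * (\prod_(kl | kl != ij) b kl)%N%:Z.
Definition scaled_mx a b s : 'M[int]_d.+1 := \matrix_(i, j) scaled_entry a b s (i, j).
Definition fraction_mx a b s : 'M[R]_d.+1 :=
  \matrix_(i, j) fraction R (a (i, j)) (b (i, j)) (s (i, j)).

Lemma scaled_mxE a b s : (forall ij, 0 < b ij)%N ->
  map_mx intr (scaled_mx a b s) = (common_den b)%:R *: fraction_mx a b s.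
Proof.
move=> b0; apply/matrixP => i j; rewrite !mxE /scaled_entry /fraction.
have -> : common_den b = (b (i, j) * \prod_(kl | kl != (i, j)) b kl)%N.
  by rewrite /common_den (bigD1 (i, j)).
rewrite !intrM intr_sign -!pmulrn natrM.
have : (b (i, j))%:R != 0 :> R by rewrite pnatr_eq0 -lt0n.
by move=> bn; field.
Qed.

Lemma det_scaled a b s N z : (forall ij, 0 < b ij)%N ->
  (`|\det (scaled_mx a b s ^+ N - ((z * common_den b ^ N)%N%:Z)%:M)|%N)%:R =
  (common_den b)%:R ^+ (N * d.+1) * `|\det (fraction_mx a b s ^+ N - z%:R%:M)| :> R.
Proof.
move=> b0; rewrite natr_absz intr_norm -det_map_mx map_mxB map_scalar_mx rmorphXn /=.
rewrite scaled_mxE // exprZn.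
have -> : ((z * common_den b ^ N)%N%:~R)%:M = (common_den b)%:R ^+ N *: (z%:R%:M : 'M[R]_d.+1).
  by rewrite -pmulrn natrM natrX scale_scalar_mx mulrC.
by rewrite -scalerBr detZ normrM ger0_norm ?exprn_ge0 // exprM.
Qed.

Lemma common_den_gt0 b : (forall ij, 0 < b ij)%N -> (0 < common_den b)%N.
Proof. by move=> b0; apply: prodn_gt0. Qed.

(** The inequality [(d+2)^(d+1) (p/q)^N + 2^-k E < |det (B^N - z)|] for the
    matrix [B] of fractions, multiplied by the denominators; [E] is the modulus
    of continuity that pays for the distance of [B] to the plant. *)
Definition growth_test (p q k N z h : nat) a b s : bool :=
  (common_den b ^ (N * d.+1) * (2 ^ k * (d.+2 ^ d.+1 * p ^ N) + det_modulus d N h * q ^ N)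
   < q ^ N * 2 ^ k *
     `|\det (scaled_mx a b s ^+ N - ((z * common_den b ^ N)%N%:Z)%:M)|)%N.

Lemma growth_testE p q k N z h a b s : (0 < q)%N -> (forall ij, 0 < b ij)%N ->
  growth_test p q k N z h a b s =
  (d.+2%:R ^+ d.+1 * (p%:R / q%:R) ^+ N + 2 ^- k * (det_modulus d N h)%:R
    < `|\det (fraction_mx a b s ^+ N - z%:R%:M)|).
Proof.
move=> q0 b0; rewrite /growth_test; move: (det_modulus d N h) => E.
rewrite -(ltr_nat R) !natrM det_scaled // natrD !natrM !natrX.
set D := (common_den b)%:R; set P := p%:R; set Q := q%:R; set T := `|_|.
set K := 2 ^+ k; set V := _ ^+ d.+1.
have D0 : 0 < D ^+ (N * d.+1) by rewrite exprn_gt0 // ltr0n common_den_gt0.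
have Q0 : 0 < Q ^+ N by rewrite exprn_gt0 // ltr0n.
have K0 : 0 < K by rewrite exprn_gt0.
have -> : D ^+ (N * d.+1) * (K * (V * P ^+ N) + E%:R * Q ^+ N) =
    (D ^+ (N * d.+1) * (K * Q ^+ N)) * (V * (P / Q) ^+ N + K^-1 * E%:R).
  rewrite expr_div_n; field.
  by rewrite !gt_eqF.
have -> : Q ^+ N * K * (D ^+ (N * d.+1) * T) = (D ^+ (N * d.+1) * (K * Q ^+ N)) * T by ring.
by rewrite ltr_pM2l // !mulr_gt0.
Qed.

(** The bound [h] on the entries is chosen before the precision [k]: the modulus
    depends on [h], and only then can [2^-k] be made small against it. *)
Lemma plant_test (t : 'I_d.+1 -> 'I_d.+1 -> seq_prog) (A : 'M[R]_d.+1) p q :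
  (forall i j, describes_real (t i j) (A i j)) -> (0 < p)%N -> (0 < q)%N ->
  p%:R / q%:R < mahler (eigenvalues A) <->
  exists k N z h a b s, (forall ij, approx (t ij.1 ij.2) k (a ij) (b ij) (s ij)) /\
    [&& (z <= d.+1)%N, [forall ij, (a ij < h * b ij)%N]
      & growth_test p q k N.+1 z h.+1 a b s].
Proof.
move=> tA p0 q0.
have c0 : 0 < p%:R / q%:R :> R by rewrite divr_gt0 ?ltr0n.
rewrite mahler_gt_det //.
have close k h a b s : (forall ij, approx (t ij.1 ij.2) k (a ij) (b ij) (s ij)) ->
   (forall ij, a ij < h * b ij)%N ->
   [/\ forall ij, (0 < b ij)%N, bounded_entries h.+1%:R (fraction_mx a b s),
       bounded_entries h.+1%:R A & close_entries (2 ^- k) A (fraction_mx a b s)].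
  move=> ap ah.
  have b0 ij : (0 < b ij)%N by have [_ /(_ _ _ _ _ (ap ij))[]] := approxP (tA ij.1 ij.2).
  have cl i j : `|A i j - fraction R (a (i, j)) (b (i, j)) (s (i, j))| < 2 ^- k.
    by have [_ /(_ _ _ _ _ (ap (i, j)))[]] := approxP (tA i j).
  have bd i j : `|fraction R (a (i, j)) (b (i, j)) (s (i, j))| <= h%:R.
    rewrite /fraction !normrM normrX normrN1 expr1n mul1r normfV !normr_nat.
    by rewrite ler_pdivrMr ?ltr0n // -natrM ler_nat ltnW.
  have k1 : 2 ^- k <= 1 :> R by rewrite invf_le1 ?exprn_gt0 // exprn_ege1 // ler1n.
  split=> // i j; rewrite ?mxE; have := bd i j; have := cl i j.
  - by rewrite -[h.+1%:R]natr1; lra.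
  - rewrite -[h.+1%:R]natr1; have := ler_normD (A i j - fraction R (a (i, j)) (b (i, j)) (s (i,
    j)))
                      (fraction R (a (i, j)) (b (i, j)) (s (i, j))).
    by rewrite subrK; lra.
  - by move=> /ltW ? _.
split=> [[N [z [zd lt]]]|[k [N [z [h [a [b [s [ap /and3P[zd /forallP ah gt]]]]]]]]]]; last first.
  exists N, z; split=> //.
  have [b0 bB bA cAB] := close _ _ _ _ _ ap ah.
  move: gt; rewrite growth_testE // => gt.
  have e0 : 0 <= 2 ^- k :> R by rewrite invr_ge0 exprn_ge0.
  have := det_expr_close N.+1 e0 (ltn0Sn h) zd bA bB cAB; rewrite distrC.
  have := ler_normD (\det (fraction_mx a b s ^+ N.+1 - z%:R%:M) - \det (A ^+ N.+1 - z%:R%:M))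
                    (\det (A ^+ N.+1 - z%:R%:M)).
  rewrite subrK; lra.
(* The margin 1 leaves room for the distance of an approximation to the entry. *)
pose h := (Num.truncn (\sum_ij `|A ij.1 ij.2|)).+2.
have hA i j : `|A i j| + 1 < h%:R.
  rewrite /h -natr1 ltrD2r.
  have := truncnS_gt (\sum_ij `|A ij.1 ij.2|); apply: le_lt_trans.
  by rewrite (bigD1 (i, j)) //= lerDl sumr_ge0.
set c := p%:R / q%:R in lt *.
set E := det_modulus d N.+1 h.+1.
set g := `|\det (A ^+ N.+1 - z%:R%:M)| in lt.
have [|k hk] := @half_pow_small R ((g - d.+2%:R ^+ d.+1 * c ^+ N.+1) / (2 * E.+1%:R)).
  by rewrite divr_gt0 ?mulr_gt0 ?subr_gt0 ?ltr0n.
have ex ij : exists abs : nat * nat * nat, approx (t ij.1 ij.2) k abs.1.1 abs.1.2 abs.2.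
  have [/(_ k)[a [b [s h']]] _] := approxP (tA ij.1 ij.2); by exists (a, b, s).
have [f hf] := choice ex.
pose a ij := (f ij).1.1; pose b ij := (f ij).1.2; pose s ij := (f ij).2.
have k1 : 2 ^- k <= 1 :> R by rewrite invf_le1 ?exprn_gt0 // exprn_ege1 // ler1n.
have ah ij : (a ij < h * b ij)%N.
  have [_ /(_ _ _ _ _ (hf ij))[b0 cl]] := approxP (tA ij.1 ij.2).
  have : `|fraction R (a ij) (b ij) (s ij)| < h%:R.
    have := ler_normB (A ij.1 ij.2) (A ij.1 ij.2 - fraction R (a ij) (b ij) (s ij)).
    rewrite subKr; have := hA ij.1 ij.2; move: cl; rewrite /a /b /s; lra.
  rewrite /fraction !normrM normrX normrN1 expr1n mul1r normfV !normr_nat.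
  by rewrite ltr_pdivrMr ?ltr0n // -natrM ltr_nat.
have [b0 bB bA cAB] := close k h a b s hf ah.
exists k, N, z, h, a, b, s; split=> //; apply/and3P; split=> //; first exact/forallP.
rewrite growth_testE //.
have e0 : 0 <= 2 ^- k :> R by rewrite invr_ge0 exprn_ge0.
have := det_expr_close N.+1 e0 (ltn0Sn h) zd bA bB cAB.
have := ler_normD (\det (A ^+ N.+1 - z%:R%:M) - \det (fraction_mx a b s ^+ N.+1 - z%:R%:M))
                  (\det (fraction_mx a b s ^+ N.+1 - z%:R%:M)).
rewrite subrK -/E -/g -/c.
move: hk; rewrite ltr_pdivlMr ?mulr_gt0 ?ltr0n // -natr1 => hk.
have := mulr_ge0 e0 (ler0n R E); lra.
Qed.

End Plant.

(** * The semi-decision procedure *)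

(** The codes of the three programs that describe a real are found at
    positions [n], [n + 1], [n + 2] of the environment. *)
Definition approxc (e : env) (n k a b s : nat) : Prop :=
  evalc (e n) (lcode [:: k]) a /\ evalc (e n.+1) (lcode [:: k]) b /\
  evalc (e n.+2) (lcode [:: k]) s.

Definition describes_at (e : env) (n : nat) (t : seq_prog) : Prop :=
  [/\ e n = gnum (num_prog t), e n.+1 = gnum (den_prog t) & e n.+2 = gnum (sgn_prog t)].

Lemma approxcP e n t k a b s : describes_at e n t ->
  approxc e n k a b s <-> approx t k a b s.
Proof.
move=> [h1 h2 h3]; rewrite /approxc h1 h2 h3 !eval_evalc.
by split=> [[? [? ?]]|[? ? ?]].
Qed.

Lemma semidec_approxc (r : nat -> nat) n k a b s : computable k -> computable a ->
  computable b -> computable s ->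
  semidec (fun e => approxc (fun i => e (r i)) n (k e) (a e) (b e) (s e)).
Proof.
move=> hk ha hb hs.
have hl : computable (fun e => lcode [:: k e]) by apply: computable_succ;
  apply: computable_npair hk computable_0.
by apply: semidec_and; [|apply: semidec_and]; apply: semidec_evalc => //; exact: computable_var.
Qed.

Definition positivec (n : nat) (e : env) : Prop :=
  exists k a b s, approxc e n k a b s /\ (~~ odd s && (b <= a * 2 ^ k)%N).

Lemma semidec_positivec n : semidec (positivec n).
Proof.
do 4 apply: semidec_ex; apply: semidec_and.
  exact: (@semidec_approxc (fun i => i.+4) n _ _ _ _ (computable_var 3) (computable_var 2)
    (computable_var 1) (computable_var 0)).
apply: semidec_bool; apply: computable_andb;
  first exact: computable_negb (computable_odd (computable_var 0)).
apply: computable_leq (computable_var 1) (computable_mul (computable_var 2) (computable_exp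
  (computable_const 2) (computable_var 3))).
Qed.

Lemma positivecP (R : realType) n e t (x : R) : describes_at e n t -> describes_real t x ->
  positivec n e <-> 0 < x.
Proof.
move=> het htx; rewrite (pos_approx htx).
by split=> -[k [a [b [s [h ?]]]]]; exists k, a, b, s; split=> //; apply/(approxcP _ _ _ _ het).
Qed.

Section PlantCode.
Variables (d p q : nat).
Local Notation I := ('I_d.+1 * 'I_d.+1)%type.
Variable pos : I -> nat.

Definition plantc (e : env) : Prop :=
  exists k N z h ca cb cs,
    (forall ij : I, approxc e (pos ij) k (vdecode ca ij) (vdecode cb ij) (vdecode cs ij)) /\
    ((z <= d.+1)%N /\ ((forall ij : I, (vdecode ca ij < h * vdecode cb ij)%N) /\
    growth_test p q k N.+1 z h.+1 (vdecode ca : I -> nat) (vdecode cb) (vdecode cs))).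

Lemma computable_vdecode (c : env -> nat) (ij : I) : computable c ->
  computable (fun e => vdecode (c e) ij).
Proof. by move=> hc; apply: computable_lnth hc (computable_const _). Qed.

Lemma computable_common_den c : computable c ->
  computable (fun e => common_den (vdecode (c e) : I -> nat)).
Proof. by move=> hc; apply: computable_prod_fin => ij; apply: computable_vdecode. Qed.

Lemma computable_det_modulus N h : computable N -> computable h ->
  computable (fun e => det_modulus d (N e) (h e)).
Proof.
move=> hN hh; have hdh : computable (fun e => d.+1 * h e)%N by apply: computable_mul
  (computable_const _) hh.
apply: computable_mul (computable_mul (computable_const _) (computable_exp (computable_mul
  (computable_const 2) _) (computable_const _))) _.
  exact: computable_add (computable_exp hdh hN) (computable_const _).
exact: computable_exp (computable_mul (computable_const 2) hdh) hN.
Qed.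

Lemma computable_growth_test k N z h ca cb cs :
  computable k -> computable N -> computable z -> computable h -> computable ca ->
    computable cb -> computable cs ->
  computable (fun e => growth_test p q (k e) (N e) (z e) (h e)
    (vdecode (ca e) : I -> nat) (vdecode (cb e)) (vdecode (cs e)) : nat).
Proof.
move=> hk hN hz hh ha hb hs; have hD := computable_common_den hb.
apply: computable_ltn.
  apply: computable_mul; first exact: computable_exp hD (computable_mul hN (computable_const _)).
  apply: computable_add.
    apply: computable_mul (computable_exp (computable_const 2) hk) _.
    exact: computable_mul (computable_const _) (computable_exp (computable_const p) hN).
  exact: computable_mul (computable_det_modulus hN hh) (computable_exp (computable_const q) hN).
apply: computable_mul; first exact: computable_mul (computable_exp (computable_const q) hN)
  (computable_exp (computable_const 2) hk).
apply: computable_absz; apply: computableZ_det => i j.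
have hC : computable_mx (fun e => scaled_mx (vdecode (ca e) : I ->
  nat) (vdecode (cb e)) (vdecode (cs e))).
  move=> i' j'; apply: (@eq_computableZ (fun e => scaled_entry (vdecode (ca e) : I -> nat)
     (vdecode (cb e)) (vdecode (cs e)) (i', j'))) => [e|]; first by rewrite mxE.
  apply: computableZ_mul; last by apply/computableZ_nat/computable_prod_fin => ij;
    exact: computable_vdecode.
  apply: computableZ_mul; first exact: computableZ_sign (computable_vdecode _ hs).
  exact: computableZ_nat (computable_vdecode _ ha).
apply: (@eq_computableZ (fun e => (scaled_mx (vdecode (ca e) : I -> nat) (vdecode (cb e))
    (vdecode (cs e)) ^+ N e) i j + - ((z e * common_den (vdecode (cb e) : I -> nat) ^ N e
    * (i == j))%N%:Z))) => [e|].
  rewrite !mxE; move: (z e * _)%N => m.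
  by case: (i == j); rewrite ?muln1 ?muln0 ?mulr1n ?mulr0n.
apply: computableZ_add; first exact: computable_mx_expr.
apply: computableZ_opp; apply: computableZ_nat; apply: computable_mul (computable_const _).
exact: computable_mul hz (computable_exp hD hN).
Qed.

Lemma semidec_plantc : semidec plantc.
Proof.
do 7 apply: semidec_ex; apply: semidec_and.
  apply: semidec_all => ij.
  exact: (@semidec_approxc (fun i => i.+4.+3) (pos ij) _ _ _ _ (computable_var 6)
     (computable_vdecode _ (computable_var 2)) (computable_vdecode _ (computable_var 1))
       (computable_vdecode _ (computable_var 0))).
apply: semidec_and; first exact: semidec_bool (computable_leq (computable_var 4)
  (computable_const _)).
apply: semidec_and.
  apply: semidec_all => ij; apply: semidec_bool;
    apply: computable_ltn (computable_vdecode _ (computable_var 2)) _.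
  exact: computable_mul (computable_var 3) (computable_vdecode _ (computable_var 1)).
apply: semidec_bool; apply: (@computable_growth_test (fun e => e 6%N) (fun e => (e 5%N).+1)
  (fun e => e 4%N) (fun e => (e 3%N).+1) (fun e => e 2%N) (fun e => e 1%N) (fun e => e 0%N));
  try exact: computable_succ (computable_var _); exact: computable_var.
Qed.

Lemma plantcP (R : realType) (t : 'I_d.+1 -> 'I_d.+1 -> seq_prog) (A : 'M[R]_d.+1) e :
  (forall i j, describes_real (t i j) (A i j)) ->
  (forall i j, describes_at e (pos (i, j)) (t i j)) -> (0 < p)%N -> (0 < q)%N ->
  plantc e <-> p%:R / q%:R < mahler (eigenvalues A).
Proof.
move=> tA et p0 q0; rewrite (plant_test tA p0 q0); split.
  move=> [k [N [z [h [ca [cb [cs [ap [zd [ah gt]]]]]]]]]].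
  exists k, N, z, h, (vdecode ca), (vdecode cb), (vdecode cs); split.
    by move=> [i j]; apply/(approxcP _ _ _ _ (et i j)).
  by apply/and3P; split=> //; apply/forallP.
move=> [k [N [z [h [a [b [s [ap /and3P[zd /forallP ah gt]]]]]]]]].
exists k, N, z, h, (vcode a), (vcode b), (vcode s); rewrite !vcodeK; split=> //.
by move=> [i j]; apply/(approxcP _ _ _ _ (et i j)); exact: ap (i, j).
Qed.

End PlantCode.

Section Input.
Variables (n : nat) (X Y : finType).

Definition entry_key : Type := (('I_n * 'I_n) + (X * Y))%type.

Definition entry_keys : seq entry_key :=
  [seq inl (i, j) | i <- enum 'I_n, j <- enum 'I_n] ++
  [seq inr (x, y) | x <- enum X, y <- enum Y].

Definition entry_prog (D : pair_prog n X Y) (k : entry_key) : seq_prog :=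
  match k with inl ij => D.1 ij.1 ij.2 | inr xy => D.2 xy.1 xy.2 end.

Definition prog_codes (t : seq_prog) : seq nat :=
  [:: gnum (num_prog t); gnum (den_prog t); gnum (sgn_prog t)].

Definition input_codes (D : pair_prog n X Y) : seq nat :=
  flatten [seq prog_codes (entry_prog D k) | k <- entry_keys].

(** Every described real takes three numbers of the input. *)
Definition entry_pos (k : entry_key) : nat := (3 * index k entry_keys)%N.

Lemma word_of_flatten ll : word_of (flatten ll) = flatten [seq word_of l | l <- ll].
Proof.
by rewrite /word_of map_flatten; elim: ll => //= l ll IH; rewrite flatten_cat IH.
Qed.

Lemma pair_prog_wordE D : pair_prog_word D = word_of (input_codes D).
Proof.
have E t : seq_prog_word t = word_of (prog_codes t).
  by rewrite /seq_prog_word /word_of /= cats0.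
rewrite /input_codes word_of_flatten -map_comp /entry_keys map_cat flatten_cat.
rewrite /pair_prog_word; congr (flatten _ ++ flatten _).
  by rewrite map_allpairs; apply: eq_allpairs => i j /=; rewrite E.
by rewrite map_allpairs; apply: eq_allpairs => i j /=; rewrite E.
Qed.

Lemma size_input_codes D : size (input_codes D) = (3 * size entry_keys)%N.
Proof.
rewrite /input_codes; elim: entry_keys => //= k l IH.
by rewrite IH mulnS.
Qed.

Lemma mem_entry_keys k : k \in entry_keys.
Proof.
rewrite /entry_keys mem_cat; case: k => -[u v]; apply/orP; [left|right];
  by apply/allpairsP; exists (u, v); split=> //=; rewrite mem_enum.
Qed.

Lemma describes_at_entry D k : describes_at (nth 0%N (input_codes D)) (entry_pos k) (entry_prog
  D k).
Proof.
rewrite /input_codes /entry_pos; have := mem_entry_keys k.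
elim: entry_keys => //= k' l IH; rewrite inE [k' == k]eq_sym.
have [<- _|_ /= kl] := eqVneq k k'; first by rewrite muln0.
by rewrite mulnS; have [h1 h2 h3] := IH kl; split.
Qed.

End Input.

Theorem theorem28 (R : realType) (n : nat) (X Y : finType) (hn : (1 <= n)%N) :
  semi_decidable (@pair_prog_word n X Y) (@describes_pair R n X Y)
    (@plant R n `*` @channel R X Y)%classic
    (@S_SE_FB_unsolvable R n X Y).
Proof.
split; first by move=> AW [].
case: n hn => // d _.
pose posW (xy : X * Y) := entry_pos (inr xy : entry_key d.+1 X Y).
pose posA ij := entry_pos (inl ij : entry_key d.+1 X Y).
(* The fraction that belongs to each support is a constant of the machine: it
   only has to exist. *)
have /choice [Q hQ] : forall S : {set X * Y}, exists Q : env -> Prop, semidec Q /\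
    forall (A : 'M[R]_d.+1) (t : 'I_d.+1 -> 'I_d.+1 -> seq_prog) e,
      (forall i j, describes_real (t i j) (A i j)) ->
      (forall i j, describes_at e (posA (i, j)) (t i j)) ->
      Q e <-> (C0FB (indicator R S) < (eta A)%:E)%E.
  move=> S; have [never|[p [q [p0 q0 hpq]]]] := C0FB_indicator_lt R S.
    exists (fun=> False); split.
      by apply: eq_semidec (semidec_bool (t := fun=> false) computable_0) => e.
    by move=> A t e _ _; split=> //; rewrite eta_mahler; apply: never; exact: mahler_ge1.
  exists (plantc p q posA); split; first exact: semidec_plantc.
  move=> A t e tA et; rewrite (plantcP tA et p0 q0) eta_mahler hpq //.
  exact: mahler_ge1.
have [] := @semidec_tm (3 * size (entry_keys d.+1 X Y)) (fun e => exists S : {set X * Y},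
    (forall xy, xy \in S -> positivec (posW xy) e) /\ Q S e).
  apply: semidec_any => S; apply: semidec_and; last by have [] := hQ S.
  apply: semidec_all => xy; apply: semidec_imply;
    [exact: computable_const | exact: semidec_positivec].
move=> T hT; exists T => D [A W] [/= pA cW] [/= dA dW].
pose e := nth 0%N (input_codes D).
have E : tm_halts T (pair_prog_word D) <-> S_SE_FB_unsolvable (A, W).
  rewrite pair_prog_wordE hT ?size_input_codes // -/e.
  have W0 : channel_ge0 W by move=> x y; have [[h _] _] := cW x; exact: h.
  have hA i j : describes_at e (posA (i, j)) (D.1 i j).
    exact: (describes_at_entry D (inl (i, j))).
  have hS (S : {set X * Y}) : (forall xy, xy \in S -> positivec (posW xy) e) <->
      (forall x y, (x, y) \in S -> 0 < W x y).
    have pos x y : positivec (posW (x, y)) e <-> 0 < W x y.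
      exact: positivecP (describes_at_entry D (inr (x, y))) (dW x y).
    by split=> [h x y /h /pos|h [x y] /h /pos].
  rewrite /S_SE_FB_unsolvable /=; split.
    move=> [S [/hS SW /(proj2 (hQ S) A D.1 e dA hA) lt]].
    by split=> //; apply/C0FB_lt_support => //; exists S.
  move=> [_ /(C0FB_lt_support _ W0) [S [SW lt]]].
  exists S; split; first exact/hS.
  exact/(proj2 (hQ S) A D.1 e dA hA).
by split=> h; [exact/E | move=> /E].
Qed.
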